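(* The following hold. (1) Let $\varphi$ be an increasing and superadditive function on the positive integers (with positive integer values), and for each positive integer $n$ let $\varphi_\Sigma^{-1}(n)=\min\{\ell\in\mathbb{Z}: n\le\sum_{i=1}^{\ell}\varphi(i)\}$. Then $j_{\mathcal{S}_\varphi}(n)\in\Theta(\varphi_\Sigma^{-1}(n))$. (2) For all positive integers $n,k$, let $p_k(n)=n^k$ and $e_k(n)=k^n$. Then $j_{\mathcal{S}_{p_k}}(n)\in\Theta(n^{\frac{1}{k+1}})$ and (for $k\ge2$) $j_{\mathcal{S}_{e_k}}(n)\in\Theta(\log_k n)$. (3) For a fixed positive integer $k$ with $k\ge2$, $j_{k\mathcal{S}_1}(n)\in\Theta(\log n)$. (4) If $k$ (a positive integer with $k\ge 2$) is not fixed, then $j_{k\mathcal{S}_1}(n)\in\Theta(\frac1k\log n)$. (5) $j_{\mathcal{S}_2}(n)\in\Theta(\sqrt{\log n})$ and $j_{\mathcal{S}_3}(n)\in\Theta(\sqrt{\log^* n})$.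
   Context: $\mathbb{N}$ is the set of positive integers, $\mathbb{N}_0=\mathbb{N}\cup\{0\}$. $\Theta$ is the usual order-of-magnitude notation: two-sided bounds up to positive constant factors. In (1)-(3) the constants may depend on the given $\varphi$ or $k$; in (4) $k$ is treated as a variable, not as a constant. Logarithms without base have base $2$. Let $\tau(0,r)=r$, $\tau(i,r)=2^{\tau(i-1,r)}$ for $i\in\mathbb{N}$, and $\log^* r=\min\{i\in\mathbb{N}_0: r\le\tau(i,1)\}$. Superadditive: $\varphi(a)+\varphi(b)\le\varphi(a+b)$ for all $a,b\in\mathbb{N}$. For nonempty sets, $E<F$ means $\max E<\min F$. Families (all contain $\emptyset$ by convention): - $\mathcal{S}_\varphi=\{F\subseteq\mathbb{N}:|F|\le\varphi(\min F)\}$; $\mathcal{S}_1=\{F\subseteq\mathbb{N}:|F|\le\min F\}$; - $k\mathcal{S}_1=\{F\subseteq\mathbb{N}: F=\bigcup_{i=1}^kE_i\text{ for some }E_1,\dots,E_k\in\mathcal{S}_1\}$; - $\mathcal{S}_2$: sets $F=\bigcup_{i=1}^\ell E_i$ with nonempty $E_1<\dots<E_\ell$ in $\mathcal{S}_1$ and $\{\min E_i:1\le i\le \ell\}\in\mathcal{S}_1$; - $\mathcal{S}_3$: sets $F=\bigcup_{i=1}^\ell E_i$ with nonempty $E_1<\dots<E_\ell$ in $\mathcal{S}_2$ and $\{\min E_i:1\le i\le \ell\}\in\mathcal{S}_1$. For a family $\mathcal{F}$ of finite subsets of $\mathbb{N}$ (each of those above): $c_{00}$ is the space of finitely supported real sequences,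 $e_i^*(x)=x_i$, $\mathrm{supp}\,x=\{i:x_i\ne0\}$; for a linear functional $f$, $\mathrm{supp}\,f=\{i:f(e_i)\ne0\}$, where $e_i$ is the $i$-th unit vector. $W_0(\mathcal{F})=\{\pm e_i^*:i\in\mathbb{N}\}$ and $W_{m+1}(\mathcal{F})$ is the union of $W_m(\mathcal{F})$ and the set of all $\frac12\sum_{i=1}^df_i$ with $d\in\mathbb{N}$, $f_i\in W_m(\mathcal{F})$, $\mathrm{supp}\,f_1<\dots<\mathrm{supp}\,f_d$ and $\{\min\mathrm{supp}\,f_i:1\le i\le d\}\in\mathcal{F}$. $W(\mathcal{F})=\bigcup_{m\in\mathbb{N}_0}W_m(\mathcal{F})$; $\|x\|_{\mathcal{F}}=\sup\{f(x):f\in W(\mathcal{F})\}$; $\mathrm{depth}_{\mathcal{F}}(f)=\min\{m\in\mathbb{N}_0:f\in W_m(\mathcal{F})\}$; $j_{\mathcal{F}}(x)=\min\{\mathrm{depth}_{\mathcal{F}}(f):f\in W(\mathcal{F}),f(x)=\|x\|_{\mathcal{F}}\}$; $j_{\mathcal{F}}(n)=\max\{j_{\mathcal{F}}(x):x\in c_{00},\ \mathrm{supp}\,x\subseteq\{1,\dots,n\}\}$.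
   Formalization: In (4), bounds uniform over all k ≥ 2 and all large n fail (n fixed, k large: j = 1 while (1/k) log n → 0), so Θ is taken as (1/k) log n → ∞: absolute constants, for all k ≥ 2 and n with (1/k) log n beyond an absolute threshold. *)

(* Defs.v *)
From HB Require Import structures.
From mathcomp Require Import all_boot all_order all_algebra finmap.
From mathcomp Require Import all_classical all_reals all_analysis.

Set Implicit Arguments.
Unset Strict Implicit.
Unset Printing Implicit Defensive.

Import Order.TTheory GRing.Theory Num.Theory.
Import numFieldNormedType.Exports.

Local Open Scope classical_set_scope.
Local Open Scope ring_scope.

(* Positive integers are represented in nat: sets in a family omit 0, W has no
   functional e_0^*, and norm_depth_max only ranges over vectors supported in
   {1, ..., n}. *)

(* The default x0 is returned when A has no least (resp. greatest) element. *)
Definition minimum d (T : porderType d) (x0 : T) (A : set T) : T :=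
  xget x0 (A `&` lbound A).

Definition maximum d (T : porderType d) (x0 : T) (A : set T) : T :=
  xget x0 (A `&` ubound A).

Definition set_lt (A B : set nat) : Prop :=
  [/\ A !=set0, B !=set0 & forall a b, A a -> B b -> (a < b)%N].

Definition fset_min (E : {fset nat}) : nat := minimum 0%N [set` E].

Definition nat_family := set {fset nat}.

Definition S_ (phi : nat -> nat) : nat_family :=
  [set E | (forall i, i \in E -> (0 < i)%N) /\
           (E = fset0 \/ (#|` E| <= phi (fset_min E))%N)].

Definition S1 : nat_family := S_ id.

Definition union_family (k : nat) (F : nat_family) : nat_family :=
  [set E | exists G : 'I_k -> {fset nat},
     (forall i, F (G i)) /\ E = \big[fsetU/fset0]_(i < k) G i].

(* l = 0 is allowed and yields the empty set. *)
Definition compose_family (G F : nat_family) : nat_family :=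
  [set E | exists (l : nat) (H : 'I_l -> {fset nat}),
     [/\ forall i, H i != fset0 /\ F (H i),
         forall i j : 'I_l, (i < j)%N -> set_lt [set` H i] [set` H j],
         G [fset fset_min (H i) | i in 'I_l]%fset
       & E = \big[fsetU/fset0]_(i < l) H i]].

Definition S2 : nat_family := compose_family S1 S1.
Definition S3 : nat_family := compose_family S1 S2.

Section Norm.
Variable R : realType.

Definition c00 := {fsfun nat -> R with 0}.

Definition functional := c00 -> R.

Definition unit_vec (i : nat) : c00 := [fsfun j in [fset i]%fset => 1 | 0].

Definition estar (i : nat) : functional := fun x => x i.

Definition supp (f : functional) : set nat := [set i | f (unit_vec i) != 0].

Fixpoint W_level (F : nat_family) (m : nat) : set functional :=
  if m is m'.+1 then
    W_level F m' `|`
    [set f | exists (d : nat) (g : 'I_d -> functional),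
       [/\ (0 < d)%N,
           forall i, W_level F m' (g i),
           forall i j : 'I_d, (i < j)%N -> set_lt (supp (g i)) (supp (g j)),
           F [fset minimum 0%N (supp (g i)) | i in 'I_d]%fset
         & f = (fun x => 2^-1 * \sum_(i < d) g i x)]]
  else
    [set f | exists2 i, (0 < i)%N & f = estar i \/ f = (fun x => - estar i x)].

Definition W (F : nat_family) : set functional := \bigcup_m W_level F m.

Definition norm (F : nat_family) (x : c00) : \bar R :=
  ereal_sup [set (f x)%:E | f in W F].

(* The three quantities below are extended reals, so that a missing minimum or
   maximum is recorded as +oo and cannot be mistaken for a depth. *)
Definition depth (F : nat_family) (f : functional) : \bar R :=
  minimum +oo%E [set m%:R%:E | m in [set m | W_level F m f]].

Definition norm_depth (F : nat_family) (x : c00) : \bar R :=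
  minimum +oo%E [set depth F f | f in [set f | W F f /\ (f x)%:E = norm F x]].

Definition norm_depth_max (F : nat_family) (n : nat) : \bar R :=
  maximum +oo%E [set norm_depth F x |
    x in [set x : c00 | forall i, i \in finsupp x -> (1 <= i <= n)%N]].

(* fine sends +oo to 0: where the growth rate on the other side of a Theta is
   positive, the lower bound forces norm_depth_max F n to be finite. *)
Definition j (F : nat_family) (n : nat) : R := fine (norm_depth_max F n).

Definition log (b : R) (x : R) : R := ln x / ln b.

(* The parameter tends to infinity along pairs (k, n) with k >= 2 for which
   (log n) / k is large; k itself is not bounded.  The bare condition
   "n large" would not do: for 3 <= n < 2 ^ k the set {1, ..., n} belongs to
   union_family k S1, whence j = 1, while (log n) / k can be arbitrarily small. *)
Definition multiple_infty : set_system (nat * nat) :=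
  filter_from [set: R] (fun M =>
    [set kn | (2 <= kn.1)%N /\ M <= kn.1%:R^-1 * log 2 kn.2%:R]).

End Norm.

(* As n > 0 and the sum is empty for l <= 0, the minimum over the integers is
   the minimum over nat. *)
Definition phi_sum_inv (phi : nat -> nat) (n : nat) : nat :=
  minimum 0%N [set l : nat | (n <= \sum_(1 <= i < l.+1) phi i)%N].

Fixpoint tau (i r : nat) : nat := if i is i'.+1 then (2 ^ tau i' r)%N else r.

Definition log_star (r : nat) : nat := minimum 0%N [set i | (r <= tau i 1)%N].

(* Main.v *)
(* Upper bound.  If allowing level D+1 instead of D increases the norm of a
   vector supported in {1, ..., n}, then there is a chain of D+1 nested intervals
   [p_t, q_t), each of them a piece of an optimal decomposition of the previous
   one.  Replacing two generations of the chain by a single one, at the price of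
   dropping the interval below them, would strictly increase the norm; so the
   left endpoints of all other pieces in two consecutive generations never form
   a set in F.  Hence every two steps use up a definite amount of [1, n],
   measured on the scale lam (n, log n or log^* n) and depending on p_t only, and
   p_t increases within four steps, unless F is a union of k copies of S1, where
   that amount does not depend on p_t.

   Lower bound.  Start with a unit vector and pass from x, supported in
   [m+1, M], to x' = x + beta (e_m + 1_R), where beta is large compared to the
   norm of x and R is the longest interval [M+1, M+r] for which {m, m+1} u R is
   in F.  A functional norming x' gives weight 1/2 to all of {m} u R, which leaves
   room for only one more functional below its root; that one must norm x.  So
   each step raises the level of the norming functionals by one. *)

Require Import Defs.
From mathcomp Require Import all_boot all_order all_algebra finmap.
From mathcomp Require Import all_classical all_reals all_analysis.
From mathcomp Require Import zify lra.
Import Order.TTheory GRing.Theory Num.Theory.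
Import numFieldNormedType.Exports.
Local Open Scope classical_set_scope.
Local Open Scope ring_scope.
Set Implicit Arguments.
Unset Strict Implicit.
Unset Printing Implicit Defensive.

(** * Families of finite sets *)

(** The families enter only through [regular], [swappable], [doublable], [gap] and [bounded];
    everything else is uniform. [gap] gives a length [w p] that a set starting at [p] is sure to
    accommodate, [bounded] a length [w' m] that it cannot exceed, and both estimates add such
    lengths over consecutive left endpoints until [lam n] is used up. This is where the rates come
    from: the depth is comparable to the l with phi(1) + ... + phi(l) ~ n for [S_ phi], with k l ~
    log n for k copies of [S1], with l ^ 2 ~ log n for [S2], and with l ^ 2 ~ log^* n for [S3].

    The upper bound compares decompositions, whereas [norm] is a supremum over infinitely many
    functionals whose supports have holes. It is therefore proved for [Nrm], a finite maximum over
    lists of left endpoints, and transferred back by [W_le_Nrm] and [Nrm_attained]. For k copies of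
    [S1] the parts of a set may interleave, so cutting from left to right cannot give [bounded] or
    [swappable]; a weight argument and an exchange argument replace it. *)

Lemma minimum_nat (A : set nat) : A !=set0 ->
  A (minimum 0%N A) /\ forall i, A i -> (minimum 0%N A <= i)%N.
Proof.
move=> [a Aa].
have exA : exists n, `[< A n >] by exists a; apply/asboolP.
have Am : (A `&` lbound A) (ex_minn exA).
  case: ex_minnP => m /asboolP Am minm; split => // i Ai; rewrite leEnat.
  exact/minm/asboolP.
by have [] := xgetPex 0%N (ex_intro _ _ Am).
Qed.

Lemma fset_min_mem (E : {fset nat}) (i : nat) : i \in E ->
  fset_min E \in E /\ (fset_min E <= i)%N.
Proof.
move=> iE; have [mE minE] := @minimum_nat [set` E] (ex_intro _ i iE).
by split => //; apply: minE.
Qed.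

Local Open Scope fset_scope.

Definition itv (p q : nat) : {fset nat} := [fset i in iota p (q - p)].

Lemma mem_itv p q i : (i \in itv p q) = (p <= i < q)%N.
Proof. by rewrite !inE mem_iota; lia. Qed.

Lemma card_itv p q : #|` itv p q| = (q - p)%N.
Proof. by rewrite card_fseq undup_id ?iota_uniq// size_iota. Qed.

Local Notation below c E := [fset i in E | (i < c)%N].
Local Notation above c E := [fset i in E | (c <= i)%N].

Lemma fsep_sub (P : pred nat) (A B : {fset nat}) :
  A `<=` B -> [fset i in A | P i] `<=` [fset i in B | P i].
Proof.
move=> /fsubsetP AB; apply/fsubsetP => i; rewrite !inE.
by move=> /andP[/AB -> ->].
Qed.

Lemma fsep_subset (P : pred nat) (A : {fset nat}) :
  [fset i in A | P i] `<=` A.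
Proof. by apply/fsubsetP => i; rewrite !inE => /andP[]. Qed.

Definition hereditary (F : nat_family) := forall A B : {fset nat},
  A `<=` B -> F B -> F A.

Definition spreading (F : nat_family) := forall (h : nat -> nat) (A : {fset nat}),
  {in A &, {homo h : i j / (i < j)%N}} -> {in A, forall i, (i <= h i)%N} ->
  F A -> F [fset h i | i in A].

(* A norming functional may use a later index a for the slot of m.+1 in
   {m, m+1} u R; the maximality of R must still apply to it. *)
Definition swappable (F : nat_family) := forall (m a : nat) (E : {fset nat}),
  (1 < m < a)%N -> {in E, forall i, (a < i)%N} ->
  F (m |` (a |` E)) -> F (m |` (m.+1 |` E)).

(* Forces the left endpoints of the chain to grow; false for union_family k S1, k >= 2. *)
Definition doublable (F : nat_family) := forall (p : nat) (A B : {fset nat}),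
  {in A & B, forall i j, (i < j)%N} -> {in A, forall i, (p.*2 <= i)%N} ->
  {in B, forall i, (p.*2 <= i)%N} -> F (p |` A) -> F (p |` B) -> F (A `|` B).

(** Containing [S1] supplies the short sets of late elements in [good_four] and the four-element
    sets from which [tops_exist] starts. *)
Record regular (F : nat_family) : Prop := Regular {
  regular_pos : forall E, F E -> {in E, forall i, (0 < i)%N};
  regular_hereditary : hereditary F;
  regular_spreading : spreading F;
  regular_S1 : forall E, {in E, forall i, (0 < i)%N && (#|` E| <= i)%N} -> F E }.

(** As [phi] is monotone, the bound at the minimum holds at every element; in this form the empty
    set and the default value of [fset_min] need no separate treatment. *)
Lemma S_P (phi : nat -> nat) (E : {fset nat}) :
  (forall a b, (0 < a)%N -> (a <= b)%N -> (phi a <= phi b)%N) ->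
  S_ phi E <-> {in E, forall i, (0 < i)%N && (#|` E| <= phi i)%N}.
Proof.
move=> phi_mono; split=> [[Epos ES] i iE|EP].
  rewrite Epos//=; case: ES => [E0|]; first by rewrite E0 inE in iE.
  have [mE mi] := fset_min_mem iE.
  by move=> /leq_trans; apply; apply: phi_mono => //; apply: Epos.
split=> [i /EP /andP[]//|].
have [->|[i iE]] := fset_0Vmem E; first by left.
by right; have [/EP /andP[_]] := fset_min_mem iE.
Qed.

(** * The families [S_ phi] *)

Section superadditive.
Variable phi : nat -> nat.
Hypothesis phi_gt0 : forall a, (0 < a)%N -> (0 < phi a)%N.
Hypothesis phi_mono : forall a b, (0 < a)%N -> (a <= b)%N -> (phi a <= phi b)%N.
Hypothesis phi_add : forall a b, (0 < a)%N -> (0 < b)%N ->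
  (phi a + phi b <= phi (a + b))%N.

Lemma superadditive_ge_id a : (0 < a)%N -> (a <= phi a)%N.
Proof.
elim: a => // -[|a] IH _; first exact: phi_gt0.
by rewrite -addn1; apply: leq_trans (phi_add _ _) => //; rewrite leq_add ?IH ?phi_gt0.
Qed.

Lemma S_regular : regular (S_ phi).
Proof.
split => [E /S_P -/(_ phi_mono) EP i /EP /andP[]//|A B AB|h A _ hge|E EP].
- move=> /S_P -/(_ phi_mono) BP; apply/S_P => // i iA.
  have /andP[-> /=] := BP i (fsubsetP AB _ iA).
  exact/leq_trans/fsubset_leq_card.
- move=> /S_P -/(_ phi_mono) AP; apply/S_P => // _ /imfsetP[i /= iA ->].
  have /andP[i0 cA] := AP i iA; have hi := hge i iA.
  rewrite (leq_trans i0 hi)/= (leq_trans (leq_imfset_card _ _ _))//.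
  by rewrite (leq_trans cA)// phi_mono.
- apply/S_P => // i /EP /andP[i0 cE]; rewrite i0/= (leq_trans cE)//.
  exact: superadditive_ge_id.
Qed.

Lemma S_swappable : swappable (S_ phi).
Proof.
move=> m a E /andP[m1 ma] aE /S_P -/(_ phi_mono) H; apply/S_P => // i iE.
have cE : (#|` m |` (m.+1 |` E)| <= #|` m |` (a |` E)|)%N.
  rewrite !cardfsU1 !inE.
  have -> : (m \in E) = false by apply/negP => /aE; lia.
  have -> : (a \in E) = false by apply/negP => /aE; lia.
  by case: (m.+1 \in E) => /=; lia.
have mi : (m <= i)%N.
  by move: iE; rewrite !inE => /orP[/eqP->//|/orP[/eqP->//|/aE]]; lia.
have /andP[_ cm] := H m (fset1U1 _ _).
by rewrite (leq_trans cE)// ?(leq_trans cm)// ?phi_mono//; lia.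
Qed.

(** Superadditivity gives 2 phi(p) <= phi(2p): [A] and [B] have at most phi(p) elements each, and
    their union starts at 2p or later. *)
Lemma S_doublable : doublable (S_ phi).
Proof.
move=> p A B AB Ap Bp.
move=> /S_P -/(_ phi_mono) HA /S_P -/(_ phi_mono) HB; apply/S_P => // i iAB.
have /andP[p0 cA] := HA p (fset1U1 _ _).
have /andP[_ cB] := HB p (fset1U1 _ _).
have ip : (p.*2 <= i)%N by move: iAB; rewrite inE => /orP[/Ap|/Bp].
have [sA sB] : A `<=` p |` A /\ B `<=` p |` B by split; apply: fsubsetUr.
have := leq_trans (fsubset_leq_card sA) cA.
have := leq_trans (fsubset_leq_card sB) cB => cB' cA'.
have cAB : (#|` A `|` B| <= #|` A| + #|` B|)%N by rewrite cardfsU leq_subr.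
have pp : (phi p + phi p <= phi p.*2)%N by rewrite -addnn; exact: phi_add.
have pi : (phi p.*2 <= phi i)%N by apply: phi_mono => //; lia.
rewrite (leq_trans _ ip) ?double_gt0//= (leq_trans cAB)// (leq_trans _ pi)//.
by rewrite (leq_trans _ pp)// leq_add.
Qed.

End superadditive.

(** Transports a threshold along an increasing map, for [blk_spreading]: the new threshold lies just
    above the images of the elements below [c]. *)
Lemma fset_cut (h : nat -> nat) (E : {fset nat}) (c : nat) :
  {in E &, {homo h : i j / (i < j)%N}} ->
  exists c', {in E, forall i, (h i < c')%N = (i < c)%N}.
Proof.
move=> hE; exists (\max_(i <- enum_fset (below c E)) (h i).+1) => i iE.
apply/idP/idP => [|ic]; last first.
  by apply: (@leq_bigmax_seq _ _ _ (fun i => (h i).+1)) => //; rewrite !inE iE.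
apply: contraTT; rewrite -!leqNgt => ci.
apply/bigmax_leqP_seq => k; rewrite !inE => /andP[kE kc] _.
by apply: hE => //; apply: leq_trans ci.
Qed.

(** Unions of at most [l] successive members of [F]. Thresholds instead of a list of pieces allow
    empty pieces, so that passing to subsets and images is a plain induction. *)
Fixpoint blk (F : nat_family) (l : nat) (E : {fset nat}) : Prop :=
  if l is l'.+1 then exists c, F (below c E) /\ blk F l' (above c E)
  else E = fset0.

Section blk.
Variable F : nat_family.
Hypothesis FR : regular F.

Lemma blk_hereditary l A B : A `<=` B -> blk F l B -> blk F l A.
Proof.
elim: l A B => [|l IH] A B AB /=; first by move=> B0; apply/eqP; rewrite -fsubset0 -B0.
case=> c [FB bB]; exists c; split; last exact: IH (fsep_sub _ AB) bB.
exact: regular_hereditary FR _ _ (fsep_sub _ AB) FB.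
Qed.

Lemma regular0 : F fset0.
Proof. by apply: (regular_S1 FR) => i; rewrite inE. Qed.

Lemma blk0 l : blk F l fset0.
Proof.
elim: l => //= l IH; exists 1%N; split.
  by apply: regular_hereditary FR _ _ _ regular0; apply: fsep_subset.
by apply: blk_hereditary _ IH; apply: fsep_subset.
Qed.

Lemma blk_add l1 l2 c E : blk F l1 (below c E) -> blk F l2 (above c E) ->
  blk F (l1 + l2) E.
Proof.
elim: l1 E => [|l1 IH] E /=.
  move=> E0; apply: blk_hereditary; apply/fsubsetP => i iE.
  rewrite !inE iE/= leqNgt; apply/negP => ic.
  by move/fsetP : E0 => /(_ i); rewrite !inE iE ic.
(* Truncating the cut at [c] keeps the first piece from absorbing elements that belong to the second
   decomposition. *)
move=> [c1 [F1 b1] b2]; exists (minn c c1); split.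
  apply: regular_hereditary FR _ _ _ F1.
  by apply/fsubsetP => i; rewrite !inE leq_min => /and3P[-> -> ->].
apply: IH.
  apply: blk_hereditary _ b1.
  apply/fsubsetP => i; rewrite !inE geq_min => /andP[/andP[-> +] ic].
  by rewrite ic leqNgt ic.
apply: blk_hereditary _ b2; apply/fsubsetP => i; rewrite !inE.
by case/andP => /andP[-> _] ->.
Qed.

Lemma blk1 E : F E -> blk F 1 E.
Proof.
move=> FE; exists (\max_(i <- enum_fset E) i).+1; split.
  by apply: regular_hereditary FR _ _ _ FE; apply: fsep_subset.
apply/fsetP => i; rewrite !inE; apply/negP => /andP[iE].
by apply/negP; rewrite -ltnNge ltnS (@leq_bigmax_seq _ _ _ id).
Qed.

Lemma blk_leq l1 l2 E : (l1 <= l2)%N -> blk F l1 E -> blk F l2 E.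
Proof.
move=> /subnKC <- b1; apply: (@blk_add _ _ (\max_(i <- enum_fset E) i).+1).
  by apply: blk_hereditary _ b1; apply/fsubsetP => i; rewrite !inE => /andP[].
apply: blk_hereditary _ (blk0 _); apply/fsubsetP => i; rewrite !inE => /andP[iE].
by rewrite leqNgt ltnS (@leq_bigmax_seq _ _ _ id).
Qed.

Lemma blkU l1 l2 A B : {in A & B, forall i j, (i < j)%N} ->
  blk F l1 A -> blk F l2 B -> blk F (l1 + l2) (A `|` B).
Proof.
move=> AB bA bB; apply: (@blk_add _ _ (\max_(i <- enum_fset A) i.+1)).
  apply: blk_hereditary _ bA; apply/fsubsetP => i; rewrite !inE.
  case/andP => /orP[//|iB]; rewrite ltnNge; apply: contraNT => _.
  by apply/bigmax_leqP_seq => j jA _; apply: AB.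
apply: blk_hereditary _ bB; apply/fsubsetP => i; rewrite !inE.
case/andP => /orP[iA|//]; rewrite leqNgt => /negP[].
by apply: (@leq_bigmax_seq _ _ _ S).
Qed.

Lemma blk_spreading l : spreading (blk F l).
Proof.
elim: l => [|l IH] h A hA hge /=.
  by move=> A0; apply/fsetP => i; rewrite !inE; apply/negP => /imfsetP[j /=]; rewrite A0 inE.
move=> [c [FA bA]]; have [c' hc] := fset_cut c hA.
have sA (P : pred nat) : {subset [fset i in A | P i] <= A}.
  by move=> i; rewrite !inE => /andP[].
exists c'; split.
  apply: regular_hereditary FR _ _ _ (regular_spreading FR (h := h) _ _ FA).
  - apply/fsubsetP => x; rewrite !inE => /andP[/imfsetP[i /= iA ->{x}]].
    by rewrite hc// => ic; apply/imfsetP; exists i; rewrite //= !inE iA.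
  - by move=> i j /sA iA /sA jA; apply: hA.
  - by move=> i /sA; apply: hge.
apply: blk_hereditary _ (IH h _ _ _ bA).
- apply/fsubsetP => x; rewrite !inE => /andP[/imfsetP[i /= iA ->{x}]].
  rewrite leqNgt hc// -leqNgt => ic.
  by apply/imfsetP; exists i; rewrite //= !inE iA.
- by move=> i j /sA iA /sA jA; apply: hA.
- by move=> i /sA; apply: hge.
Qed.

End blk.

Lemma card_fset_ord l (f : 'I_l -> nat) : (#|` [fset f i | i in 'I_l]| <= l)%N.
Proof.
apply: leq_trans (leq_imfset_card _ _ _) _.
by rewrite -[leqRHS]card_ord -(card_uniqP (enum_finmem_uniq _)) max_card.
Qed.

Lemma card_fset_ord_mono l (f : 'I_l -> nat) :
  (forall i j : 'I_l, (i < j)%N -> (f i < f j)%N) ->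
  #|` [fset f i | i in 'I_l]| = l.
Proof.
move=> fM; rewrite card_in_imfset; last first.
  move=> i j _ _ fij; apply: val_inj; have [/fM|/fM|//] := ltngtP i j;
    by rewrite fij ltnn.
set s := enum_finmem _; have /card_uniqP <- : uniq s := enum_finmem_uniq _.
rewrite -[RHS]card_ord.
by apply: eq_card => i; rewrite enum_finmemE.
Qed.

Lemma bigfsetUP l (G : 'I_l -> {fset nat}) x :
  reflect (exists k, x \in G k) (x \in \big[fsetU/fset0]_(i < l) G i).
Proof.
apply: (iffP (bigfcupP _ _ _ _)) => [[k _ xk]|[k xk]]; first by exists k.
by exists k; rewrite ?mem_index_enum.
Qed.

Lemma fset_minP (E : {fset nat}) : E != fset0 ->
  fset_min E \in E /\ {in E, forall i, (fset_min E <= i)%N}.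
Proof.
move=> /fset0Pn[i iE]; split; first by have [] := fset_min_mem iE.
by move=> k /fset_min_mem[].
Qed.

(** * Composition with [S1] *)

Section compose.
Variable F : nat_family.
Hypothesis FR : regular F.

(** Bridge to the indexed unions of [compose_family]; empty pieces are dropped, whence [l' <= l]
    rather than equality. *)
Lemma blkP l E : blk F l E <-> exists (l' : nat) (H : 'I_l' -> {fset nat}),
  [/\ (l' <= l)%N, forall i, H i != fset0 /\ F (H i),
      forall i j : 'I_l', (i < j)%N -> {in H i & H j, forall a b, (a < b)%N}
    & E = \big[fsetU/fset0]_(i < l') H i].
Proof.
split.
  elim: l E => [|l IH] E /=.
    move=> ->; exists 0%N, (fun=> fset0); split => //; try by case.
    by rewrite big_ord0.
  move=> [c [Fc /IH[l' [H [l'l HF Hlt Ec]]]]].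
  have EE : E = below c E `|` above c E.
    by apply/fsetP => i; rewrite !inE -andb_orr ltnNge orNb andbT.
  have [B0|B0] := eqVneq (below c E) fset0.
    exists l', H; split => //; first exact: leqW.
    by rewrite -Ec {1}EE B0 fset0U.
  exists l'.+1, (fun i => if unlift ord0 i is Some j then H j else below c E).
  split=> // [i|i j|].
  - by case: unliftP.
  - case: unliftP => [i' ->|->]; case: unliftP => [j' ->|->]; rewrite ?ltnn//.
      by rewrite !lift0 ltnS; exact: Hlt.
    move=> _ a b; rewrite inE => /andP[_ ac] bH.
    have : b \in above c E by rewrite Ec; apply/bigfsetUP; exists j'.
    by rewrite inE => /andP[_]; apply: leq_trans.
  - rewrite big_ord_recl unlift_none {1}EE Ec; congr (_ `|` _).
    by apply: eq_bigr => i _; rewrite liftK.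
move=> [l' [H [l'l HF Hlt ->]]]; apply: (blk_leq FR l'l).
elim: l' H HF Hlt {l'l} => [|l' IH] H HF Hlt; first by rewrite big_ord0.
rewrite big_ord_recl; apply: (@blkU _ FR 1 l') => //.
- move=> a b a0 /bigfsetUP[i bi]; apply: Hlt a0 bi => //.
- by apply: blk1 => //; case: (HF ord0).
- by apply: IH => // i j ij; apply: Hlt.
Qed.

(** The minima of the pieces form a set of [S1] when the pieces are at most as many as the least
    element of [E]. Since [blk] is monotone in the number of pieces, this may be asked at every
    element, as in [S_P]. *)
Lemma composeP E : compose_family S1 F E <->
  {in E, forall i, (0 < i)%N /\ blk F i E}.
Proof.
have id_mono a b : (0 < a)%N -> (a <= b)%N -> (id a <= id b)%N by [].
have set_ltP (A B : {fset nat}) : A != fset0 -> B != fset0 ->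
    set_lt [set` A] [set` B] <-> {in A & B, forall a b, (a < b)%N}.
  move=> /fset0Pn[a aA] /fset0Pn[b bB]; split=> [[_ _ AB] x y|AB]; first exact: AB.
  by split; [exists a|exists b|move=> x y; exact: AB].
split.
  move=> [l [H [HF Hlt /S_P -/(_ id_mono) HS ->]]] i /bigfsetUP[k ik].
  split; first exact: (regular_pos FR (HF k).2).
  have [kmin /(_ _ ik) ki] := fset_minP (HF k).1.
  have /HS/andP[_] : fset_min (H k) \in [fset fset_min (H i) | i in 'I_l].
    by apply/imfsetP; exists k.
  rewrite card_fset_ord_mono => [|u v uv]; last first.
    have [_ _ ->//] := Hlt _ _ uv; rewrite /= /mem.
      exact: (fset_minP (HF u).1).1.
    exact: (fset_minP (HF v).1).1.
  move=> lk; apply/blkP; exists l, H; split=> //; first exact: leq_trans ki.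
  by move=> u v /Hlt; move/set_ltP; apply; apply: (HF _).1.
have [->|/fset_minP[mE minE] EP] := eqVneq E fset0.
  move=> _; exists 0%N, (fun=> fset0); split; rewrite ?big_ord0//; try by case.
  by apply/S_P => // i /imfsetP[[]].
have [_ /blkP[l [H [lm HF Hlt EH]]]] := EP _ mE.
have HE k i : i \in H k -> i \in E.
  by move=> ik; rewrite EH; apply/bigfsetUP; exists k.
exists l, H; split => //.
  by move=> i j ij; apply/set_ltP; [exact: (HF i).1|exact: (HF j).1|exact: Hlt].
apply/S_P => // i /imfsetP[k _ ->].
have /HE kE := (fset_minP (HF k).1).1.
rewrite (EP _ kE).1/= (leq_trans (card_fset_ord _))// (leq_trans lm)//.
exact: minE.
Qed.

Lemma compose_regular : regular (compose_family S1 F).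
Proof.
split => [E /composeP EP i /EP[]//|A B AB|h A hA hge|E EP].
- move=> /composeP BP; apply/composeP => i /(fsubsetP AB)/BP[i0 bB].
  by split => //; apply: blk_hereditary bB.
- move=> /composeP AP; apply/composeP => _ /imfsetP[i /= iA ->].
  have [i0 bA] := AP i iA; split; first exact: leq_trans (hge _ iA).
  by apply: (blk_leq FR (hge _ iA)); apply: blk_spreading.
- apply/composeP => i iE; have /andP[i0 _] := EP i iE; split => //.
  by apply: (blk_leq FR i0); apply: blk1 => //; apply: (regular_S1 FR).
Qed.

(** Each set uses at most [p] pieces, and 2p pieces are allowed to a set starting at 2p or later. *)
Lemma compose_doublable : doublable (compose_family S1 F).
Proof.
move=> p A B AB Ap Bp /composeP HA /composeP HB; apply/composeP => i iAB.
have [p0 bA] := HA p (fset1U1 _ _); have [_ bB] := HB p (fset1U1 _ _).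
have ip : (p.*2 <= i)%N by move: iAB; rewrite inE => /orP[/Ap|/Bp].
split; first by lia.
apply: (blk_leq FR ip); rewrite -addnn; apply: blkU => //.
  by apply: blk_hereditary bA => //; apply: fsubsetUr.
by apply: blk_hereditary bB => //; apply: fsubsetUr.
Qed.

(** Depends on the first cut [c]. If [c <= m], the first piece is empty. If m < c <= a, it contains
    only [m] and may be replaced by {m, m+1}, which is in [S1] because m >= 2. Otherwise it contains
    [m] and [a], and [F] itself is swappable. *)
Lemma blk_swap l m a E : swappable F ->
  (1 < m < a)%N -> {in E, forall i, (a < i)%N} ->
  blk F l (m |` (a |` E)) -> blk F l (m |` (m.+1 |` E)).
Proof.
move=> Fs ma aE; elim: l => [|l IH] /=.
  by move=> /fsetP/(_ m); rewrite !inE eqxx.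
move=> [c [FB bA]].
have [cm|mc] := leqP c m.
  exists 0%N; split.
    apply: (regular_hereditary FR) (regular0 FR).
    by apply/fsubsetP => i; rewrite !inE ltn0 andbF.
  apply: blk_hereditary (IH _) => //; first exact: fsep_subset.
  apply: blk_hereditary bA => //.
  apply/fsubsetP => i; rewrite !inE => iE; rewrite iE/= (leq_trans cm)//.
  by case/or3P: iE => [/eqP->//|/eqP->|/aE]; lia.
have [ca|ac] := leqP c a.
  exists m.+2; split.
    apply: (regular_hereditary FR) (regular_S1 FR (E := [fset m; m.+1]) _).
      apply/fsubsetP => i; rewrite !inE => /andP[/or3P[->//|->|/aE]]; last by lia.
      by rewrite orbT.
    by move=> i; rewrite !inE cardfs2 => /orP[]/eqP->; case: eqP; lia.
  apply: blk_hereditary bA => //; apply/fsubsetP => i; rewrite !inE.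
  case/andP => /or3P[/eqP->|/eqP->|iE]; [lia|lia|move=> _].
  by rewrite iE !orbT/= (leq_trans ca)// ltnW// aE.
exists c; split.
  apply: (regular_hereditary FR) (Fs m a (below c E) _ _ _) => //.
  - apply/fsubsetP => i; rewrite !inE => /andP[/or3P[->|->|->] ->] //=.
      by rewrite orbT.
    by rewrite !orbT.
  - by move=> i; rewrite !inE => /andP[/aE].
  - apply: (regular_hereditary FR) FB.
    apply/fsubsetP => i; rewrite !inE => /or3P[/eqP->|/eqP->|/andP[-> ->]].
    + by rewrite eqxx mc.
    + by rewrite eqxx orbT ac.
    + by rewrite !orbT.
apply: blk_hereditary bA => //; apply/fsubsetP => i; rewrite !inE.
case/andP => /or3P[/eqP->|/eqP->|->] ci; rewrite ?ci ?orbT//; lia.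
Qed.

Lemma compose_swappable : swappable F -> swappable (compose_family S1 F).
Proof.
move=> Fs m a E ma aE /composeP H; apply/composeP => i iE.
have [_ bm] := H m (fset1U1 _ _).
have mi : (m <= i)%N.
  by move: iE; rewrite !inE => /or3P[/eqP->//|/eqP->//|/aE]; lia.
split; first by lia.
exact/(blk_leq FR mi)/(blk_swap Fs ma aE).
Qed.

End compose.

(* w p is the length, on the scale lam, that a set of F with first element p can
   cover in two pieces. *)
Definition gap (F : nat_family) (lam w : nat -> nat) := forall p0 p2 q2 q0,
  (0 < p0 <= p2)%N -> (p2 <= q2 <= q0)%N ->
  (lam q0 + lam p2 < w p0 + lam q2 + lam p0)%N -> F (itv p0 p2 `|` itv q2 q0).

(** Counterpart of [gap] for the lower bound: it limits how far one step of the construction of hard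
    vectors moves the right end of the support. *)
Definition bounded (F : nat_family) (lam w : nat -> nat) := forall m M r,
  (1 < m < M)%N -> F (m |` (m.+1 |` itv M.+1 (M + r).+1)) ->
  (lam (M + r) <= lam M + w m)%N.

Lemma S1_regular : regular S1.
Proof. by apply: S_regular. Qed.

Lemma S1P E : S1 E <-> {in E, forall i, (0 < i)%N && (#|` E| <= i)%N}.
Proof. exact: S_P. Qed.

(** * Unions of k members of a family *)

Section union_family.
Variable F : nat_family.
Hypothesis FR : regular F.

Lemma union_family_hereditary k A B : A `<=` B ->
  union_family k F B -> union_family k F A.
Proof.
move=> AB [G [GF BE]]; exists (fun i => G i `&` A); split.
  by move=> i; apply: (regular_hereditary FR) (GF i); apply: fsubsetIl.
apply/fsetP => x; apply/idP/bigfsetUP => [xA|[i]]; last by rewrite inE => /andP[].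
have /bigfsetUP[i xi] : x \in \big[fsetU/fset0]_(i < k) G i.
  by rewrite -BE (fsubsetP AB).
by exists i; rewrite inE xi.
Qed.

Lemma union_familyS k A B : F A -> union_family k F B ->
  union_family k.+1 F (A `|` B).
Proof.
move=> FA [G [GF ->]].
exists (fun i : 'I_k.+1 => if unlift ord0 i is Some j then G j else A); split.
  by move=> i; case: unliftP.
rewrite big_ord_recl unlift_none; congr (_ `|` _).
by apply: eq_bigr => i _; rewrite liftK.
Qed.

Lemma blk_union_family k E : blk F k E -> union_family k F E.
Proof.
elim: k E => [|k IH] E /=.
  by move=> ->; exists (fun=> fset0); split=> [[]//|]; rewrite big_ord0.
move=> [c [FB /IH bA]]; apply: union_family_hereditary (union_familyS FB bA).
by apply/fsubsetP => i iE; rewrite !inE iE/= ltnNge orNb.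
Qed.

Lemma union_family_regular k : regular (union_family k.+1 F).
Proof.
split => [E [G [GF ->]] i /bigfsetUP[j]|A B|h A hA hge [G [GF AE]]|E EP].
- exact: (regular_pos FR (GF j)).
- exact: union_family_hereditary.
- exists (fun i => [fset h x | x in G i]); split.
    have GA i x : x \in G i -> x \in A.
      by move=> xi; rewrite AE; apply/bigfsetUP; exists i.
    move=> i; apply: (regular_spreading FR) => //.
      by move=> x y /GA xA /GA yA; apply: hA.
    by move=> x /GA; apply: hge.
  apply/fsetP => y; apply/imfsetP/bigfsetUP => [[x /= + ->]|[i /imfsetP[x /= xi ->]]].
    by rewrite AE => /bigfsetUP[i xi]; exists i; apply/imfsetP; exists x.
  by exists x => //; rewrite AE; apply/bigfsetUP; exists i.
- apply: blk_union_family; apply: (@blk_leq _ FR 1) => //.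
  by apply: blk1 => //; apply: (regular_S1 FR).
Qed.

End union_family.

(** An exchange argument: [m.+1] joins the part [G u] of [m], and [a] is deleted from all parts. If
    [G u] is full, one of its other elements moves to the place that [a] vacates in [G v]. *)
Lemma union_S1_swappable k : swappable (union_family k S1).
Proof.
move=> m a E ma aE [G [GS GE]].
have GA i x : x \in G i -> x \in m |` (a |` E).
  by move=> xi; rewrite GE; apply/bigfsetUP; exists i.
have G1 i x : x \in G i -> (#|` G i| <= x)%N.
  by move=> xi; have /S1P/(_ _ xi)/andP[] := GS i.
have [u mu] : exists u, m \in G u by apply/bigfsetUP; rewrite -GE fset1U1.
have [v av] : exists v, a \in G v.
  by apply/bigfsetUP; rewrite -GE fset1Ur// fset1U1.
have Gm i x : x \in G i -> (m <= x)%N /\ (x != m -> a <= x)%N.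
  move=> /GA; rewrite !inE => /or3P[/eqP->|/eqP->|/aE]; split; lia.
have SG i : S1 (G i `\ a).
  by apply: (regular_hereditary S1_regular) (GS i); apply: fsubD1set.
have EG x : x \in m |` E -> exists2 i, x \in G i & x != a.
  move=> xE; have xa : x != a.
    by move: xE; rewrite !inE => /orP[/eqP->|/aE]; lia.
  have /bigfsetUP[i xi] : x \in \big[fsetU/fset0]_(i < k) G i.
    by rewrite -GE; move: xE; rewrite !inE => /orP[->//|->]; rewrite !orbT.
  by exists i.
have [Gu|Gu] := leqP (#|` m.+1 |` (G u `\ a)|) m.
  pose G' i := if i == u then m.+1 |` (G u `\ a) else G i `\ a.
  apply: (@union_family_hereditary _ S1_regular _ _ (\big[fsetU/fset0]_i G' i)).
    apply/fsubsetP => x; rewrite fsetUCA in_fset1U => /orP[/eqP->|/EG[i xi xa]];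
      apply/bigfsetUP; first by exists u; rewrite /G' eqxx fset1U1.
    by exists i; rewrite /G'; case: eqVneq xi => [->|_] xi; rewrite !inE xa xi ?orbT.
  exists G'; split => // i; rewrite /G'; case: eqP => // _; apply/S1P => x xu.
  suff mx : (m <= x)%N by rewrite (leq_trans Gu mx); lia.
  by move: xu; rewrite !inE => /orP[/eqP->//|/andP[_ /Gm[]]].
have um : (#|` G u| <= m)%N by exact: G1.
have au : a \notin G u.
  apply: contraTN Gu => au; rewrite -leqNgt cardfsU1.
  by have := cardfsD1 a (G u); rewrite au; lia.
(* Here [G u] has exactly [m] elements, and m >= 2. As [c] turns out to exceed [a], it can replace
   [a] in [G v] without violating the cardinality bound. *)
have [c cu cm] : exists2 c, c \in G u & c != m.
  have : G u `\ m != fset0.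
    have Gua : G u `\ a = G u by apply/fsetDidPl; rewrite fdisjointX1.
    rewrite -cardfs_gt0; have := cardfsD1 m (G u); rewrite mu.
    by move: Gu; rewrite Gua cardfsU1; lia.
  by move=> /fset0Pn[c]; rewrite !inE => /andP[cm cu]; exists c.
have ac : (a < c)%N.
  rewrite ltn_neqAle (Gm _ _ cu).2// andbT; apply: contraNneq au => ->.
  exact: cu.
have uv : v != u by apply: contraNneq au => <-.
pose G' i := if i == u then m.+1 |` (G u `\ c) else
  if i == v then c |` (G v `\ a) else G i `\ a.
apply: (@union_family_hereditary _ S1_regular _ _ (\big[fsetU/fset0]_i G' i)).
  apply/fsubsetP => x; rewrite fsetUCA in_fset1U => /orP[/eqP->|/EG[i xi xa]];
    apply/bigfsetUP; first by exists u; rewrite /G' eqxx fset1U1.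
  have [->|xc] := eqVneq x c; first by exists v; rewrite /G' (negPf uv) eqxx fset1U1.
  exists i; rewrite /G'; case: eqVneq xi => [->|_] xi; first by rewrite !inE xc xi orbT.
  by case: eqVneq xi => [->|_] xi; rewrite !inE xa xi ?orbT.
exists G'; split => // i; rewrite /G'; case: eqP => [_|_].
  apply/S1P => x xu.
  have mx : (m <= x)%N.
    by move: xu; rewrite !inE => /orP[/eqP->//|/andP[_ /Gm[]]].
  have := cardfsD1 c (G u); rewrite cu cardfsU1; lia.
case: eqP => // _; apply/S1P => x xv.
have Gvx : (#|` G v| <= x)%N.
  move: xv; rewrite !inE => /orP[/eqP->|/andP[_ /G1//]].
  by rewrite (leq_trans (G1 _ _ av))// ltnW.
have := cardfsD1 a (G v); rewrite av cardfsU1.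
have x0 : (0 < x)%N.
  by move: xv; rewrite !inE => /orP[/eqP->|/andP[_ /Gm[]]]; lia.
by rewrite x0/= => cv; apply: leq_trans Gvx; rewrite cv leq_add2r leq_b1.
Qed.

(** Cut at 2p, 4p, 8p, ...: the interval [p, 2p) has p elements. By [itv_blk_S1] no other choice of
    pieces does better. *)
Lemma blk_S1_itv l p q : (0 < p)%N -> (q <= 2 ^ l * p)%N -> blk S1 l (itv p q).
Proof.
elim: l p => [|l IH] p p0 qp /=.
  by apply/fsetP => i; rewrite mem_itv inE; lia.
exists p.*2; split.
  apply/S1P => i; rewrite !inE mem_iota => ipq.
  have -> : below p.*2 (itv p q) = itv p (minn q p.*2).
    by apply/fsetP => j; rewrite !inE !mem_iota; lia.
  by rewrite card_itv; lia.
apply: (@blk_hereditary _ S1_regular _ _ (itv p.*2 q)); last first.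
  by apply: IH; [lia|move: qp; rewrite expnS; lia].
by apply/fsubsetP => i; rewrite !inE !mem_iota; lia.
Qed.

Lemma itv_blk_S1 l p q : (p <= q)%N -> blk S1 l (itv p q) -> (q <= 2 ^ l * p)%N.
Proof.
elim: l p => [|l IH] p pq /=.
  by move=> /fsetP/(_ p); rewrite mem_itv inE; lia.
move=> [c [FB bA]].
have [cp|pc] := leqP c p.
  have /IH -/(_ pq) : blk S1 l (itv p q).
    apply: (blk_hereditary S1_regular) bA.
    by apply/fsubsetP => i; rewrite !inE !mem_iota; lia.
  by rewrite expnS; lia.
have [pq'|] := ltnP p q; last by rewrite expnS; have := expn_gt0 2 l; nia.
have : (minn c q <= p.*2)%N.
  have pE : p \in below c (itv p q) by rewrite !inE mem_iota; lia.
  have /S1P/(_ _ pE)/andP[_] := FB.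
  have -> : below c (itv p q) = itv p (minn c q).
    by apply/fsetP => i; rewrite !inE !mem_iota; lia.
  by rewrite card_itv; lia.
have [qc|cq] := leqP q c; first by rewrite expnS; have := expn_gt0 2 l; nia.
have /(IH _ (ltnW cq)) : blk S1 l (itv c q).
  apply: (blk_hereditary S1_regular) bA.
  by apply/fsubsetP => i; rewrite !inE !mem_iota; lia.
by rewrite expnS; nia.
Qed.

(** Rounding up costs at most one additional doubling, since 2 ^ [up_log 2 x] <= 2x. *)
Lemma up_log_gap x n : (0 < x <= n)%N ->
  (n <= 2 ^ (up_log 2 n - up_log 2 x).+1 * x)%N.
Proof.
move=> /andP[x0 xn]; have := up_logP n (ltnSn 1).
have lxn := leq_up_log 2 xn.
have x2 : (2 ^ up_log 2 x <= 2 * x)%N.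
  have [x1|x1] := leqP x 1.
    have -> : x = 1%N by lia.
    by rewrite up_log1.
  have := up_log_gtn (ltnSn 1) x1.
  have : (0 < up_log 2 x)%N by rewrite up_log_gt0 x1.
  by case: up_log => //= l _; rewrite expnS; lia.
rewrite -{1}(subnK lxn) expnD expnS.
by move: (2 ^ _)%N (2 ^ _)%N x2 => a b; nia.
Qed.

(** * Towers of exponentials, [log_star] and intervals in [S2] *)

Lemma tau_exp i r : tau i (2 ^ r) = tau i.+1 r.
Proof. by elim: i => //= i ->. Qed.

Lemma tau_add i l r : tau (i + l) r = tau i (tau l r).
Proof. by elim: i => //= i ->. Qed.

Lemma leq_tau i r s : (r <= s)%N -> (tau i r <= tau i s)%N.
Proof. by elim: i => //= i IH /IH; rewrite leq_exp2l. Qed.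

Lemma tau_ge i r : (r <= tau i r)%N.
Proof. by elim: i => //= i IH; apply: leq_trans (ltnW (ltn_expl _ _)). Qed.

Lemma leq_tau_l i l r : (i <= l)%N -> (tau i r <= tau l r)%N.
Proof. by move=> /subnKC <-; rewrite addnC tau_add tau_ge. Qed.

Lemma tau_ge_id i r : (0 < r)%N -> (i < tau i r)%N.
Proof.
by move=> r0; elim: i => //= i IH; apply: leq_ltn_trans IH _; apply: ltn_expl.
Qed.

Lemma log_starP r i : (log_star r <= i)%N = (r <= tau i 1)%N.
Proof.
have [/= h1 h2] := @minimum_nat [set i | (r <= tau i 1)%N]
  (ex_intro _ r (ltnW (tau_ge_id r (ltnSn 0)))).
by apply/idP/idP => [/(leq_tau_l 1)|]; [exact: leq_trans|exact: h2].
Qed.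

Lemma leq_log_star r s : (r <= s)%N -> (log_star r <= log_star s)%N.
Proof. by move=> rs; rewrite log_starP (leq_trans rs)// -log_starP. Qed.

(** Rounding costs one additional exponential: x exceeds the tower of height [log_star x] - 1, so 2
    ^ x reaches the one of height [log_star x]. *)
Lemma log_star_gap x n : (0 < x <= n)%N ->
  (n <= tau (log_star n - log_star x).+1 x)%N.
Proof.
move=> /andP[x0 xn]; have lxn := leq_log_star xn.
have : (n <= tau (log_star n) 1)%N by rewrite -log_starP.
move=> /leq_trans; apply.
rewrite -{1}(subnK lxn) tau_add -tau_exp leq_tau//.
case E : (log_star x) => [|l] /=; first by rewrite expn_gt0.
rewrite leq_exp2l//; apply: ltnW; rewrite ltnNge -log_starP E.
by rewrite -ltnNge.
Qed.

(** Cut at 2 ^ p and iterate: p doublings lead from p to 2 ^ p p, so [p, 2 ^ p) is in [S2]. *)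
Lemma blk_S2_itv l p q : (0 < p)%N -> (q <= tau l p)%N -> blk S2 l (itv p q).
Proof.
elim: l p => [|l IH] p p0 qp /=.
  by apply/fsetP => i; rewrite mem_itv inE; move: qp => /=; lia.
exists (2 ^ p)%N; split.
  apply/(composeP S1_regular) => i; rewrite !inE mem_iota => ipq.
  split; first by lia.
  apply: (@blk_leq _ S1_regular p); first by lia.
  apply: (@blk_hereditary _ S1_regular _ _ (itv p (2 ^ p))).
    by apply/fsubsetP => j; rewrite !inE !mem_iota; lia.
  by apply: blk_S1_itv => //; rewrite leq_pmulr.
apply: (@blk_hereditary _ (compose_regular S1_regular) _ _ (itv (2 ^ p) q)).
  by apply/fsubsetP => i; rewrite !inE !mem_iota; lia.
by apply: IH; rewrite ?expn_gt0// tau_exp.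
Qed.

(** A piece starting at p ends by 2 ^ p p <= 2 ^ (2p) <= 2 ^ (2 ^ p). Allowing two exponentials for
    each piece is wasteful, but only by a constant factor in the final rate. *)
Lemma itv_blk_S2 l p q : (0 < p <= q)%N -> blk S2 l (itv p q) ->
  (q <= tau l.*2 p)%N.
Proof.
have S2R := compose_regular S1_regular.
elim: l p => [|l IH] p /andP[p0 pq] /=.
  by move=> /fsetP/(_ p); rewrite mem_itv inE; lia.
move=> [c [FB bA]]; rewrite -[leqRHS]/(tau l.*2.+2 p) -!tau_exp.
have [cp|pc] := leqP c p.
  have /IH : blk S2 l (itv p q).
    apply: (blk_hereditary S2R) bA.
    by apply/fsubsetP => i; rewrite !inE !mem_iota; lia.
  rewrite p0 pq => /(_ isT)/leq_trans; apply.
  exact/leq_tau/(tau_ge 2).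
have cq2 : (minn c q <= 2 ^ 2 ^ p)%N.
  have : blk S1 p (itv p (minn c q)).
    have [qp|pq'] := eqVneq p q.
      apply: (blk_hereditary S1_regular) (blk0 S1_regular p).
      by apply/fsubsetP => i; rewrite !inE mem_iota; lia.
    have pE : p \in below c (itv p q) by rewrite !inE mem_iota; lia.
    have /(composeP S1_regular)/(_ _ pE)[_] := FB.
    apply: (blk_hereditary S1_regular).
    by apply/fsubsetP => i; rewrite !inE !mem_iota; lia.
  move=> /itv_blk_S1 -/(_ _)/leq_trans; apply; first by lia.
  have pp : (p * 2 <= 2 ^ p)%N.
    by case: p p0 {IH pq bA FB pc} => // p _; rewrite expnS mulnC leq_mul2l ltn_expl.
  rewrite (leq_trans (leq_mul (leqnn _) (ltnW (ltn_expl p (ltnSn 1)))))//.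
  by rewrite -expnD addnn -muln2 leq_exp2l.
have [qc|cq] := leqP q c.
  by apply: leq_trans (tau_ge _ _); lia.
have /IH : blk S2 l (itv c q).
  apply: (blk_hereditary S2R) bA.
  by apply/fsubsetP => i; rewrite !inE !mem_iota; lia.
have cq' : (0 < c <= q)%N by lia.
move=> /(_ cq')/leq_trans; apply; apply: leq_tau; lia.
Qed.

(** Give i the weight 1/i. A set of [S1] weighs at most 1, since its cardinality is at most each of
    its elements, so k of them weigh at most k however they interleave. Each [r, 2r) weighs at least
    1/2, hence [p, 4 ^ k p) weighs at least k, and one more point would be too much. *)
Lemma itv_union_S1 k p q : (0 < p)%N -> union_family k S1 (itv p q) ->
  (q <= 4 ^ k * p)%N.
Proof.
move=> p0 [G [GS EG]]; rewrite leqNgt; apply/negP => kq.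
pose f (i : nat) : rat := i%:R^-1.
have f_ge0 i : 0 <= f i by rewrite invr_ge0.
have up l : l%:R <= \sum_(p <= i < 4 ^ l * p) f i.
  elim: l => [|l IH]; first by rewrite sumr_ge0.
  have half r : (0 < r)%N -> 2^-1 <= \sum_(r <= i < 2 * r) f i.
    move=> r0; have <- : \sum_(r <= i < 2 * r) ((2 * r)%:R^-1 : rat) = 2^-1.
      have -> : \sum_(r <= i < 2 * r) ((2 * r)%:R^-1 : rat) = (2 * r)%:R^-1 *+ r.
        by rewrite sumr_const_nat; congr (_ *+ _); lia.
      rewrite natrM invfM -[LHS]mulr_natr mulfVK//.
      by rewrite pnatr_eq0 -lt0n.
    rewrite !big_nat; apply: ler_sum => i /andP[ri ir].
    by rewrite /f lef_pV2 ?posrE ?ltr0n ?ler_nat; lia.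
  have lp : (0 < 4 ^ l * p)%N by rewrite muln_gt0 expn_gt0.
  rewrite (@big_cat_nat _ _ _ (4 ^ l * p)); last first.
  - by rewrite expnS; lia.
  - by rewrite leq_pmull// expn_gt0.
  rewrite (@big_cat_nat _ _ _ (2 * (4 ^ l * p)) (4 ^ l * p)); [|lia|rewrite expnS; lia].
  have -> : (4 ^ l.+1 * p = 2 * (2 * (4 ^ l * p)))%N by rewrite expnS; lia.
  have := half (4 ^ l * p)%N lp; have := half (2 * (4 ^ l * p))%N ltac:(lia).
  rewrite -[l.+1%:R]natr1; move: IH; set a := bigop _ _ _; set b := bigop _ _ _;
    set c := bigop _ _ _; move=> *; rewrite -[leRHS]/(a + (c + b))%R; lra.
have down : \sum_(p <= i < q) f i <= k%:R.
  apply: (@le_trans _ _ (\sum_(p <= i < q) \sum_(u < k) if i \in G u then f i else 0)).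
    rewrite !big_nat; apply: ler_sum => i ipq.
    have /bigfsetUP[u iu] : i \in \big[fsetU/fset0]_(u < k) G u by rewrite -EG mem_itv.
    rewrite (bigD1 u)//= iu lerDl sumr_ge0// => v _; by case: ifP.
  rewrite exchange_big -[leRHS]mulr1 -[k in leRHS]card_ord mulr_natl -sumr_const.
  apply: ler_sum => u _; rewrite -big_mkcond /= -big_filter.
  set s := [seq _ <- _ | _].
  have us : uniq s by rewrite filter_uniq// iota_uniq.
  have su : {subset s <= G u} by move=> i; rewrite mem_filter => /andP[].
  have ss : (size s <= #|` G u|)%N by apply: uniq_leq_size.
  have [->|s0] := eqVneq s [::]; first by rewrite big_nil.
  have s0' : (0 < size s)%N by rewrite lt0n size_eq0.
  apply: (@le_trans _ _ (\sum_(i <- s) (size s)%:R^-1)); last first.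
    rewrite big_const_seq count_predT iter_addr_0 -[leLHS]mulr_natr mulVf//.
    by rewrite pnatr_eq0 -lt0n.
  rewrite !big_seq; apply: ler_sum => i /su iu.
  have /S1P/(_ _ iu)/andP[i0 ci] := GS u.
  by rewrite /f lef_pV2 ?posrE ?ltr0n// ler_nat; lia.
have := up k.
have : \sum_(p <= i < q) f i =
    (\sum_(p <= i < 4 ^ k * p) f i + \sum_(4 ^ k * p <= i < q) f i)%R.
  by rewrite -big_cat_nat// ?(ltnW kq)// leq_pmull// expn_gt0.
have : 0 < \sum_(4 ^ k * p <= i < q) f i.
  rewrite big_ltn// ltr_pwDl ?sumr_ge0// invr_gt0 ltr0n muln_gt0 expn_gt0//.
lra.
Qed.

(** * The scales and lengths of the individual families *)

Section superadditive_gap.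
Variable phi : nat -> nat.
Hypothesis phi_mono : forall a b, (0 < a)%N -> (a <= b)%N -> (phi a <= phi b)%N.

Lemma S_gap : gap (S_ phi) id phi.
Proof.
move=> p0 p2 q2 q0 /andP[p00 p02] /andP[pq2 q20] H; apply/S_P => // i.
rewrite !inE !mem_iota => iE.
have p0i : (p0 <= i)%N by lia.
rewrite (leq_trans p00)//= (leq_trans _ (phi_mono p00 p0i))//.
have := cardfsU (itv p0 p2) (itv q2 q0); rewrite !card_itv; move: H; simpl; lia.
Qed.

Lemma S_bounded : bounded (S_ phi) id phi.
Proof.
move=> m M r mM /S_P -/(_ phi_mono) H; rewrite leq_add2l.
have /andP[_] := H m (fset1U1 _ _); apply: leq_trans.
apply: (@leq_trans #|` itv M.+1 (M + r).+1|); first by rewrite card_itv; lia.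
by apply: fsubset_leq_card; rewrite fsetUA fsubsetUr.
Qed.

End superadditive_gap.

Lemma itv_fsubset2 m M q : itv M.+1 q `<=` m |` (m.+1 |` itv M.+1 q).
Proof. by rewrite fsetUA fsubsetUr. Qed.

Lemma itv_lt p0 p2 q2 q0 : (p2 <= q2)%N ->
  {in itv p0 p2 & itv q2 q0, forall i j, (i < j)%N}.
Proof. by move=> pq i j; rewrite !mem_itv; lia. Qed.

Lemma up_log_bound M n l : (0 < M)%N -> (n < 2 ^ l * M.+1)%N ->
  (up_log 2 n <= up_log 2 M + l.+1)%N.
Proof.
move=> M0 nM; apply: up_log_min => //; rewrite expnD expnS.
have := up_logP M (ltnSn 1); move: (2 ^ up_log 2 M)%N (2 ^ l)%N nM => a b; nia.
Qed.

(** Each of the two intervals may need one piece more than its length in [up_log], and the strict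
    inequality of [gap] gives one unit back: hence [k.-1]. The [predn] for [S2] and [S3] has the
    same origin. *)
Lemma union_S1_gap k : gap (union_family k S1) (up_log 2) (fun=> k.-1).
Proof.
move=> p0 p2 q2 q0 /andP[p00 p02] /andP[pq2 q20] H.
apply: blk_union_family; first exact: S1_regular.
apply: (@blk_leq _ S1_regular ((up_log 2 p2 - up_log 2 p0).+1 + (up_log 2 q0 - up_log 2 q2).+1)).
  by have := leq_up_log 2 p02; have := leq_up_log 2 q20; lia.
apply: (blkU S1_regular) (itv_lt pq2) _ _; apply: blk_S1_itv => //; try lia.
  by apply: up_log_gap; lia.
by apply: up_log_gap; lia.
Qed.

(** A factor 4 ^ k is 2k doublings; the additional unit pays for starting at M + 1 instead of M. *)
Lemma union_S1_bounded k : bounded (union_family k S1) (up_log 2) (fun=> k.*2.+1).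
Proof.
move=> m M r mM /(union_family_hereditary S1_regular (itv_fsubset2 _ _ _)).
move=> /itv_union_S1 -/(_ isT) H; apply: (@up_log_bound _ _ k.*2); first lia.
by rewrite -muln2 [(k * 2)%N]mulnC expnM.
Qed.

Lemma S2_regular : regular S2.
Proof. exact: (compose_regular S1_regular). Qed.

Lemma S2_gap : gap S2 (up_log 2) predn.
Proof.
move=> p0 p2 q2 q0 /andP[p00 p02] /andP[pq2 q20] H.
apply/(composeP S1_regular) => i; rewrite !inE !mem_iota => iE; split; first lia.
apply: (@blk_leq _ S1_regular ((up_log 2 p2 - up_log 2 p0).+1 + (up_log 2 q0 - up_log 2 q2).+1)).
  by have := leq_up_log 2 p02; have := leq_up_log 2 q20; lia.
apply: (blkU S1_regular) (itv_lt pq2) _ _; apply: blk_S1_itv => //; try lia.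
  by apply: up_log_gap; lia.
by apply: up_log_gap; lia.
Qed.

Lemma S2_bounded : bounded S2 (up_log 2) S.
Proof.
move=> m M r mM /(composeP S1_regular)/(_ m (fset1U1 _ _))[_].
move=> /(blk_hereditary S1_regular (itv_fsubset2 _ _ _)) H.
apply: up_log_bound; first lia.
by apply: itv_blk_S1 H; lia.
Qed.

Lemma S3_gap : gap S3 log_star predn.
Proof.
move=> p0 p2 q2 q0 /andP[p00 p02] /andP[pq2 q20] H.
apply/(composeP S2_regular) => i; rewrite !inE !mem_iota => iE; split; first lia.
apply: (@blk_leq _ S2_regular ((log_star p2 - log_star p0).+1 + (log_star q0 - log_star q2).+1)).
  by have := leq_log_star p02; have := leq_log_star q20; lia.
apply: (blkU S2_regular) (itv_lt pq2) _ _; apply: blk_S2_itv => //; try lia.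
  by apply: log_star_gap; lia.
by apply: log_star_gap; lia.
Qed.

Lemma S3_bounded : bounded S3 log_star (fun m => m.*2.+1).
Proof.
move=> m M r mM /(composeP S2_regular)/(_ m (fset1U1 _ _))[_].
move=> /(blk_hereditary S2_regular (itv_fsubset2 _ _ _)) /itv_blk_S2 H.
have {H}Mr : (M + r < tau m.*2 M.+1)%N by apply: H; lia.
(* The additional unit absorbs the start at M + 1, because M + 1 <= 2 ^ M. *)
rewrite addnS -addSn log_starP.
apply: leq_trans (ltnW Mr) _; rewrite addnC tau_add; apply: leq_tau.
apply: (@leq_trans (2 ^ M)); first exact: ltn_expl.
by rewrite /= leq_exp2l// -log_starP.
Qed.

Local Close Scope fset_scope.

(** * Norms of a fixed vector on intervals *)

Section W_facts.
Variables (R : realType) (F : nat_family).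
Implicit Types (f : functional R) (x : c00 R).

Lemma unit_vecE i k : (unit_vec R i) k = (k == i)%:R.
Proof. by rewrite /unit_vec fsfunE in_fset1; case: eqP. Qed.

Lemma suppE f i : supp f i = (f (unit_vec R i) != 0) :> Prop.
Proof. by []. Qed.

Lemma W_level_le m1 m2 f : (m1 <= m2)%N -> W_level F m1 f -> W_level F m2 f.
Proof.
by move=> /subnKC <- Wf; elim: (m2 - m1)%N => [|d IH]; rewrite ?addn0// addnS; left.
Qed.

Lemma W_level_ind (P : nat -> functional R -> Prop) :
  (forall i, (0 < i)%N -> P 0%N (estar i) /\ P 0%N (fun x => - estar i x)) ->
  (forall m f, P m f -> P m.+1 f) ->
  (forall m d (g : 'I_d -> functional R), (0 < d)%N -> (forall i, W_level F m (g i)) ->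
     (forall i, P m (g i)) ->
     (forall i j : 'I_d, (i < j)%N -> set_lt (supp (g i)) (supp (g j))) ->
     F [fset minimum 0%N (supp (g i)) | i in 'I_d]%fset ->
     P m.+1 (fun x => 2^-1 * \sum_(i < d) g i x)) ->
  forall m f, W_level F m f -> P m f.
Proof.
move=> P0 PS PD; elim=> [|m IH] f /=; first by case=> i /P0[? ?] [->|->].
case=> [/IH/PS//|[d [g [d0 Wg Sg Fg ->]]]].
by apply: PD => // i; apply: IH.
Qed.

Lemma estar_supp (i k : nat) : estar i (unit_vec R k) != 0 -> k = i.
Proof. by rewrite /estar unit_vecE; case: (eqVneq i k) => //; rewrite eqxx. Qed.

Lemma sum_coef d (g : 'I_d -> functional R) (k : 'I_d) (y : nat) :
  (forall i j : 'I_d, (i < j)%N -> set_lt (supp (g i)) (supp (g j))) ->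
  supp (g k) y -> \sum_(i < d) g i (unit_vec R y) = g k (unit_vec R y).
Proof.
move=> Sg ky; rewrite (bigD1 k)//= big1 ?addr0// => i ik.
apply/eqP/negP => /negP iy.
have [/Sg[_ _ /(_ y y iy ky)]|/Sg[_ _ /(_ y y ky iy)]|/val_inj ki] := ltngtP i k.
- by rewrite ltnn.
- by rewrite ltnn.
- by rewrite ki eqxx in ik.
Qed.

Lemma sum_coef_neq0 d (g : 'I_d -> functional R) (y : nat) :
  \sum_(i < d) g i (unit_vec R y) != 0 -> exists k, supp (g k) y.
Proof.
move=> /eqP sy; apply: contrapT => H; apply: sy; apply: big1 => i _.
by apply/eqP/negP => /negP iy; apply: H; exists i.
Qed.

Lemma W_supp m f : W_level F m f -> supp f !=set0 /\
  exists B, forall i, supp f i -> (0 < i < B)%N.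
Proof.
move: m f; apply: W_level_ind => [i i0|//|m d g d0 _ IH Sg _].
  split; split; try (by exists i; rewrite suppE /estar unit_vecE eqxx ?oppr_eq0 oner_eq0);
    exists i.+1 => k; rewrite suppE ?oppr_eq0 => /estar_supp ->; lia.
split.
  have [[y gy] _] := IH (Ordinal d0); exists y.
  by rewrite suppE mulf_neq0 ?invr_eq0// (sum_coef Sg gy).
have [B hB] := choice (fun i => (IH i).2).
exists (\max_i B i) => y; rewrite suppE mulf_eq0 negb_or => /andP[_ /sum_coef_neq0[k ky]].
have /andP[-> yB] := hB _ _ ky; apply: leq_trans yB _.
exact: leq_bigmax.
Qed.

Lemma W_min m f : W_level F m f -> supp f (minimum 0%N (supp f)) /\
  forall i, supp f i -> (minimum 0%N (supp f) <= i)%N.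
Proof. by move=> /W_supp[/minimum_nat]. Qed.

(** A [functional] is an arbitrary map; the linearity of the members of [W] is recovered here, in
    coordinates. *)
Lemma W_linear m f : W_level F m f -> forall x B, (forall i, x i != 0 -> (i < B)%N) ->
  f x = \sum_(i < B) x i * f (unit_vec R i).
Proof.
move: m f; apply: W_level_ind => [i i0|//|m d g d0 _ IH _ _ x B xB].
  have H x B : (forall i, x i != 0 -> (i < B)%N) ->
      estar i x = \sum_(k < B) x k * estar i (unit_vec R k).
    move=> xB; rewrite /estar; have [iB|Bi] := ltnP i B.
      rewrite (bigD1 (Ordinal iB))//= unit_vecE eqxx mulr1 big1 ?addr0// => k ki.
      rewrite unit_vecE; case: eqP => [ik|]; last by rewrite mulr0.
      by case/eqP: ki; apply: val_inj.
    rewrite big1 => [|k _]; last first.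
      by rewrite unit_vecE; case: eqP => [ik|]; rewrite ?mulr0//; have := ltn_ord k; lia.
    by apply/eqP; apply: contraTT Bi => /xB; rewrite -ltnNge.
  split=> // x B /H ->; rewrite -sumrN; apply: eq_bigr => k _.
  by rewrite -mulrN.
transitivity (2^-1 * \sum_(i < d) \sum_(k < B) x k * g i (unit_vec R k)).
  by congr (_ * _); apply: eq_bigr => i _; apply: IH.
rewrite exchange_big mulr_sumr; apply: eq_bigr => k _.
by rewrite -mulr_sumr mulrCA.
Qed.

End W_facts.

Lemma bigmax_attained (R : realDomainType) (T : eqType) (r : seq T) (P : pred T)
    (f : T -> R) :
  \big[Num.max/0]_(t <- r | P t) f t = 0 \/
  exists t, [/\ t \in r, P t & \big[Num.max/0]_(t <- r | P t) f t = f t].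
Proof.
rewrite big_seq_cond; elim/big_rec: _ => [|t y /andP[rt Pt] [->|[t' [rt' Pt' ->]]]].
- by left.
- by rewrite /Num.max; case: ifP => _; [left|right; exists t].
- by right; rewrite /Num.max; case: ifP => _; [exists t'|exists t].
Qed.

Lemma mem_fset_seq (s : seq nat) i : (i \in [fset j in s]%fset) = (i \in s).
Proof. by rewrite inE. Qed.

Section tree_norm.
Variable R : realType.
Variable F : nat_family.
Hypothesis FR : regular F.
Variable x : c00 R.

Definition fam (s : seq nat) : Prop := F [fset i in s]%fset.

Lemma fam_sub (s1 s2 : seq nat) : {subset s1 <= s2} -> fam s2 -> fam s1.
Proof.
move=> s12; apply: (regular_hereditary FR).
by apply/fsubsetP => i; rewrite !inE; apply: s12.
Qed.

Fixpoint sumN (N : nat -> nat -> R) (s : seq nat) (b : nat) : R :=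
  if s is a :: s' then N a (head b s') + sumN N s' b else 0.

(* The norm of the restriction of x to [a, b) for functionals of level m.  The
   pieces of a decomposition are extended to the left endpoint of the next one. *)
Fixpoint Nrm (m a b : nat) : R :=
  if m is m'.+1 then
    Num.max (Nrm m' a b)
      (\big[Num.max/0]_(t : (b - a).-tuple bool |
          `[< fam (mask t (index_iota a b)) >])
        (2^-1 * sumN (Nrm m') (mask t (index_iota a b)) b))
  else \big[Num.max/0]_(a <= i < b) `|x i|.

Definition admissible (a b : nat) (s : seq nat) :=
  [/\ sorted ltn s, {in s, forall i, (a <= i < b)%N} & fam s].

Lemma Nrm_leS m a b : Nrm m a b <= Nrm m.+1 a b.
Proof. by rewrite /= le_max lexx. Qed.

Lemma Nrm_le m1 m2 a b : (m1 <= m2)%N -> Nrm m1 a b <= Nrm m2 a b.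
Proof.
move=> /subnKC <-; elim: (m2 - m1)%N => [|d IH]; first by rewrite addn0.
by rewrite addnS; apply: le_trans (Nrm_leS _ _ _).
Qed.

Lemma Nrm_ge0 m a b : 0 <= Nrm m a b.
Proof.
apply: le_trans (Nrm_le _ _ (leq0n m)) => /=.
by rewrite bigmax_idl le_max lexx.
Qed.

Lemma Nrm_step m a b s : admissible a b s ->
  2^-1 * sumN (Nrm m) s b <= Nrm m.+1 a b.
Proof.
move=> [ss sab Fs] /=; rewrite le_max; apply/orP; right.
(* A sorted list in [a, b) is encoded by its indicator, one of the boolean tuples over which the
   maximum in [Nrm] is taken. *)
have sE : s = mask [seq i \in s | i <- index_iota a b] (index_iota a b).
  rewrite -filter_mask; apply: (irr_sorted_eq ltn_trans ltnn) => //.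
    exact/(sorted_filter ltn_trans)/iota_ltn_sorted.
  move=> i; rewrite mem_filter mem_index_iota.
  by case: (boolP (i \in s)) => [/sab ->|].
have st : size [seq i \in s | i <- index_iota a b] == (b - a)%N.
  by rewrite size_map size_iota.
have -> : 2^-1 * sumN (Nrm m) s b =
   (fun t : (b - a).-tuple bool => 2^-1 * sumN (Nrm m) (mask t (index_iota a b)) b)
   (Tuple st) by rewrite /= -sE.
by apply: le_bigmax_cond; apply/asboolP; rewrite /= -sE.
Qed.

Lemma Nrm_case m a b : Nrm m.+1 a b = Nrm m a b \/
  exists2 s, admissible a b s & Nrm m.+1 a b = 2^-1 * sumN (Nrm m) s b.
Proof.
rewrite /= /Num.max; case: ifP => _; last by left.
have [v0|[t [_ /asboolP Ft ->]]] := bigmax_attained (index_enum _) (fun t : (b - a).-tuple bool =>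
  `[< fam (mask t (index_iota a b)) >])
  (fun t => 2^-1 * sumN (Nrm m) (mask t (index_iota a b)) b).
  (* The default value 0 of the maximum is that of the empty list, which is admissible. *)
  right; exists [::]; last by rewrite v0 mulr0.
  split => //; apply: (regular_S1 FR) => i; by rewrite !inE.
right; exists (mask t (index_iota a b)) => //; split => //.
  exact/(sorted_mask ltn_trans)/iota_ltn_sorted.
by move=> i /mem_mask; rewrite mem_index_iota.
Qed.

Lemma admissible_sub a b a' b' s : (a' <= a)%N -> (b <= b')%N ->
  admissible a b s -> admissible a' b' s.
Proof. by move=> aa bb [ss sab Fs]; split => // i /sab; lia. Qed.

Lemma sumN_le (N1 N2 : nat -> nat -> R) s b b' :
  (forall a c d, (c <= d)%N -> N1 a c <= N2 a d) -> (b <= b')%N ->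
  sumN N1 s b <= sumN N2 s b'.
Proof.
move=> N12 bb; elim: s => //= a s IH; apply: lerD => //; apply: N12.
by case: s {IH}.
Qed.

Lemma Nrm_mono m a b a' b' : (a' <= a)%N -> (b <= b')%N ->
  Nrm m a b <= Nrm m a' b'.
Proof.
elim: m a b a' b' => [|m IH] a b a' b' aa bb.
  rewrite /= big_nat; apply: bigmax_le => [|i /andP[ai ib]].
    exact: (Nrm_ge0 0).
  by apply: (le_bigmax_seq 0 i xpredT (fun i => `|x i|)) => //; rewrite mem_index_iota; lia.
have [->|[s sab ->]] := Nrm_case m a b.
  exact/(le_trans (IH _ _ _ _ aa bb))/Nrm_leS.
apply: le_trans (Nrm_step m (admissible_sub aa bb sab)).
by rewrite ler_pM2l ?invr_gt0//; apply: sumN_le => // c d e de; apply: IH.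
Qed.

Lemma sumN_cat N s1 s2 b :
  sumN N (s1 ++ s2) b = sumN N s1 (head b s2) + sumN N s2 b.
Proof.
elim: s1 => [|a s IH] /=; first by rewrite add0r.
by rewrite IH addrA; case: s {IH}.
Qed.

Lemma sumN_mono m s b b' : (b <= b')%N -> sumN (Nrm m) s b <= sumN (Nrm m) s b'.
Proof. by move=> bb; apply: sumN_le => // a c d cd; apply: Nrm_mono. Qed.

Lemma sumN_leS m s b : sumN (Nrm m) s b <= sumN (Nrm m.+1) s b.
Proof.
apply: sumN_le => // a c d cd.
exact/(le_trans (Nrm_mono _ (leqnn _) cd))/Nrm_leS.
Qed.

Lemma Nrm_nil m a b : (b <= a)%N -> Nrm m a b = 0.
Proof.
move=> ba; elim: m => [|m IH]; first by rewrite /= big_geq.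
have [->//|[s [_ sab _] ->]] := Nrm_case m a b.
case: s sab => [|i s /(_ i (mem_head _ _))]; first by rewrite mulr0.
by lia.
Qed.

(** Pieces starting at [b] or later contribute nothing and are dropped; a piece straddling [b] is
    shortened to end there. This disposes of functionals whose support exceeds that of the
    vector. *)
Lemma Nrm_trunc m a b b' : (b <= b')%N ->
  (forall i, (b <= i < b')%N -> x i = 0) -> Nrm m a b' <= Nrm m a b.
Proof.
elim: m a b b' => [|m IH] a b b' bb x0.
  rewrite /= big_nat; apply: bigmax_le => [|i /andP[ai ib]].
    exact: (Nrm_ge0 0).
  have [lt|ge] := ltnP i b; last by rewrite x0 ?ge// normr0 (Nrm_ge0 0).
  by apply: (le_bigmax_seq 0 i xpredT (fun i => `|x i|)) => //; rewrite mem_index_iota ai.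
have [->|[s [ss sab Fs] ->]] := Nrm_case m a b'.
  exact/(le_trans (IH _ _ _ bb x0))/Nrm_leS.
pose s' := [seq i <- s | (i < b)%N].
have s'b : admissible a b s'.
  split; first exact: (sorted_filter ltn_trans).
    by move=> i; rewrite mem_filter => /andP[-> /sab/andP[->]].
  by apply: fam_sub Fs => i; rewrite mem_filter => /andP[].
apply: le_trans (Nrm_step m s'b).
rewrite ler_pM2l ?invr_gt0// /s' {s' s'b Fs}.
have {}sab : {in s, forall i, (i < b')%N} by move=> i /sab/andP[].
elim: s ss sab => //= i s IHs ss sab.
have ssl : {in s, forall j, (i < j)%N}.
  by move=> j js; have /allP := order_path_min ltn_trans ss; apply.
have {IHs} : sumN (Nrm m) s b' <= sumN (Nrm m) [seq j <- s | (j < b)%N] b.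
  apply: IHs; first exact: path_sorted ss.
  by move=> j js; apply: sab; rewrite inE js orbT.
have hb : (i <= head b' s <= b')%N.
  case: s {ss} sab ssl => [|j s] sab ssl /=; first by rewrite leqnn ltnW// sab ?mem_head.
  by apply/andP; split; apply: ltnW; [apply: ssl|apply: sab]; rewrite !inE eqxx ?orbT.
have [ib|bi] /= := ltnP i b; last first.
  rewrite [X in X + _](_ : _ = 0) ?add0r//; apply/eqP.
  rewrite eq_le Nrm_ge0 andbT -(Nrm_nil m (leqnn i)).
  by apply: IH => [|k]; [lia|move=> ik; apply: x0; lia].
apply: lerD.
have -> : head b [seq j <- s | (j < b)%N] = minn (head b' s) b.
  case: s {sab hb} ss ssl => [|j s] /= ss ssl; first by rewrite (minn_idPr _).
  case: (ltnP j b) => bj //=.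
  rewrite (@eq_in_filter _ _ pred0) ?filter_pred0// => k ks /=.
  apply/negbTE; rewrite -leqNgt (leq_trans bj)//.
  move/andP: ss => [_ /(order_path_min ltn_trans)/allP/(_ _ ks)]; exact: ltnW.
by apply: IH => [|k ik]; [lia|apply: x0; lia].
Qed.

#[local] Arguments Nrm : simpl never.

(** * Chains of nested intervals on which one more level pays *)

Definition good (m p q : nat) := Nrm m p q < Nrm m.+1 p q.

(** One link of the chain: the piece starting at [p1] is the next interval, and [L] and [T] are the
    left endpoints that survive when two generations are merged. *)
Definition split_at (m p q : nat) (L : seq nat) (p1 : nat) (T : seq nat) :=
  [/\ admissible p q (L ++ p1 :: T),
      Nrm m.+2 p q = 2^-1 * (sumN (Nrm m.+1) L p1 + Nrm m.+1 p1 (head q T)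
                               + sumN (Nrm m.+1) T q)
    & good m p1 (head q T)].

Lemma sumN_lt_split m s q : sumN (Nrm m) s q < sumN (Nrm m.+1) s q ->
  exists L p1 T, s = L ++ p1 :: T /\ good m p1 (head q T).
Proof.
elim: s => [|a s IH] /=; first by rewrite ltxx.
have [g _|ng lt] := ltP (Nrm m a (head q s)) (Nrm m.+1 a (head q s)).
  by exists [::], a, s.
have /IH[L [p1 [T [-> gS]]]] : sumN (Nrm m) s q < sumN (Nrm m.+1) s q by lra.
by exists (a :: L), p1, T.
Qed.

(** If no piece of an optimal decomposition gained from its last level, the same decomposition would
    give the same value one level lower. *)
Lemma good_split m p q : good m.+1 p q -> exists L p1 T, split_at m p q L p1 T.
Proof.
move=> g; have [e|[s sab e]] := Nrm_case m.+1 p q; first by rewrite /good e ltxx in g.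
have /sumN_lt_split[L [p1 [T [sE gS]]]] : sumN (Nrm m) s q < sumN (Nrm m.+1) s q.
  rewrite -(ltr_pM2l (_ : 0 < 2^-1)) ?invr_gt0// -e.
  exact: le_lt_trans (Nrm_step m sab) g.
exists L, p1, T; split; rewrite -?sE// e sE sumN_cat /= addrA; congr (_ * (_ + _ + _)).
Qed.

Lemma admissible_split p q L p1 T : admissible p q (L ++ p1 :: T) ->
  [/\ (p <= p1 < head q T)%N /\ (head q T <= q)%N, pairwise ltn L, pairwise ltn T,
      {in L, forall i, (p <= i < p1)%N} & {in T, forall i, (head q T <= i < q)%N}].
Proof.
move=> [+ sab _]; rewrite (sorted_pairwise ltn_trans) pairwise_cat /=.
move=> /and4P[/allrelP LS pL /allP p1S pT].
have p1b := sab p1; rewrite mem_cat mem_head orbT in p1b.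
have Tb i : i \in T -> (p <= i < q)%N.
  by move=> iS; apply: sab; rewrite mem_cat inE iS !orbT.
split => //.
- case: T {LS pT sab} p1S Tb => [|j T] /= p1S Tb; first by have := p1b isT; lia.
  have /= := p1S j (mem_head _ _).
  by have := Tb j (mem_head _ _); have := p1b isT; lia.
- move=> i iL; have := sab i; rewrite mem_cat iL => /(_ isT).
  by have := LS i p1 iL (mem_head _ _); rewrite /ltn /=; lia.
- move=> i iS; have := Tb i iS.
  case: T iS pT {LS p1S sab Tb} => //= j T; rewrite inE => /orP[/eqP->|iS /andP[/allP/(_ i iS)]].
    by move=> _; rewrite leqnn => /andP[].
  by move=> /= ji _ /andP[_ ->]; rewrite ltnW.
Qed.

(* Merging the two generations and discarding everything below p2 would raise
   the norm by half of Nrm p1 q1 - Nrm p2 q2, which is positive by goodness. *)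
Lemma split_split_not_fam m p0 q0 L0 p1 T0 L1 p2 T1 :
  split_at m.+1 p0 q0 L0 p1 T0 -> split_at m p1 (head q0 T0) L1 p2 T1 ->
  ~ fam (L0 ++ L1 ++ T1 ++ T0).
Proof.
set q1 := head q0 T0; move=> [a0 e0 g1] [a1 e1 g2] Fs.
have [[p01 q01] pL0 pT0 L0b T0b] := admissible_split a0.
have [[p12 q12] pL1 pT1 L1b T1b] := admissible_split a1.
set q2 := head q1 T1 in p12 q12 T1b e1 g2.
have sa : admissible p0 q0 (L0 ++ L1 ++ T1 ++ T0).
  split => //.
    rewrite (sorted_pairwise ltn_trans) !pairwise_cat pL0 pL1 pT1 pT0 !andbT /=.
    apply/and3P; split; apply/allrelP => i j; rewrite ?mem_cat.
    - move=> /L0b ib /or3P[/L1b|/T1b|/T0b]; rewrite /ltn /=; lia.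
    - move=> /L1b ib /orP[/T1b|/T0b]; rewrite /ltn /=; lia.
    - move=> /T1b ib /T0b; rewrite /ltn /=; lia.
  move=> i; rewrite !mem_cat.
by case/or4P => [/L0b|/L1b|/T1b|/T0b]; lia.
have := Nrm_step m.+2 sa; rewrite e0 ler_pM2l ?invr_gt0// !sumN_cat.
have head_cat s1 s2 : head q0 (s1 ++ s2) = head (head q0 s2) s1 by case: s1.
have h2 : (p2 <= head q0 (T1 ++ T0))%N by rewrite head_cat -/q1 -/q2; lia.
have h1 : (p1 <= head q0 (L1 ++ T1 ++ T0))%N.
  rewrite head_cat; move: L1b h2; case: (L1) => [|j L1'] L1b h2 /=; first by lia.
  by have := L1b j (mem_head _ _); lia.
have := sumN_mono m.+2 L0 h1; have := sumN_mono m.+1 L1 h2.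
have := sumN_leS m.+1 L1 (head q0 (T1 ++ T0)); have := sumN_leS m.+1 T1 q1.
have := Nrm_mono m.+1 (_ : p1 <= p2)%N q12 => /(_ ltac:(lia)).
move: g1; rewrite /good e1 -/q1.
set u := Nrm m.+1 p2 q2; set v := Nrm m.+1 p1 q1.
lra.
Qed.

Variables lam w : nat -> nat.
Hypothesis F_gap : gap F lam w.
Hypothesis lam_mono : {homo lam : a b / (a <= b)%N}.

(** The endpoints that cannot form a set of [F] lie in [p0, p2) and [q2, q0), so [gap] forces these
    two intervals to be long. *)
Lemma split_split_gap m p0 q0 L0 p1 T0 L1 p2 T1 : (0 < p0)%N ->
  split_at m.+1 p0 q0 L0 p1 T0 -> split_at m p1 (head q0 T0) L1 p2 T1 ->
  (w p0 + lam (head (head q0 T0) T1) + lam p0 <= lam q0 + lam p2)%N.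
Proof.
move=> p00 s0 s1; rewrite leqNgt; apply/negP => lt.
apply: (split_split_not_fam s0 s1).
have [[p01 q01] _ _ L0b T0b] := admissible_split (let: And3 a _ _ := s0 in a).
have [[p12 q12] _ _ L1b T1b] := admissible_split (let: And3 a _ _ := s1 in a).
apply: (regular_hereditary FR) (F_gap _ _ lt); [|lia|lia].
apply/fsubsetP => i; rewrite in_fsetU !mem_itv mem_fset_seq !mem_cat.
by case/or4P => [/L0b|/L1b|/T1b|/T0b]; lia.
Qed.

(** If the left endpoint does not move, nothing precedes the chosen piece, and the endpoints after
    it appear in the form required by [doublable]. *)
Lemma split_same_min m p q L T : split_at m p q L p T ->
  L = [::] /\ F (p |` [fset i in T])%fset.
Proof.
move=> [a _ _]; have [_ _ _ Lb _] := admissible_split a.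
have L0 : L = [::].
  by case: L Lb {a} => // i L /(_ i (mem_head _ _)); lia.
split=> //; case: a => _ _; rewrite L0; apply: (regular_hereditary FR).
by apply/fsubsetP => i; rewrite !inE.
Qed.

(** The length comes from the first two generations. If the left endpoint stayed at p0 through all
    four, one of the two pairs of generations could be merged; which one depends on whether q2, the
    right end after two generations, reaches 2 p0. *)
Lemma good_four m p0 q0 : (0 < p0)%N -> good m.+4 p0 q0 ->
  exists p4 q4, [/\ good m p4 q4, (p0 <= p4 < q4)%N,
    (w p0 + lam q4 + lam p0 <= lam q0 + lam p4)%N & doublable F -> (p0 < p4)%N].
Proof.
move=> p00 /good_split[L0 [p1 [T0 s0]]].
have [a0 _ g1] := s0; have [L1 [p2 [T1 s1]]] := good_split g1.
have [a1 _ g2] := s1; have [L2 [p3 [T2 s2]]] := good_split g2.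
have [a2 _ g3] := s2; have [L3 [p4 [T3 s3]]] := good_split g3.
have [a3 _ g4] := s3.
have [[p01 q01] _ _ _ T0b] := admissible_split a0.
have [[p12 q12] _ pT1 _ T1b] := admissible_split a1.
have [[p23 q23] _ pT2 _ T2b] := admissible_split a2.
have [[p34 q34] _ pT3 _ T3b] := admissible_split a3.
have gap0 := split_split_gap p00 s0 s1.
exists p4, (head (head (head (head q0 T0) T1) T2) T3); split => //; first by lia.
  have l1 := lam_mono (leq_trans q34 q23).
  have l2 := lam_mono (_ : p2 <= p4)%N; have {l2} := l2 ltac:(lia); lia.
move=> Fd; rewrite ltn_neqAle; apply/andP; split; last by lia.
apply/eqP => p04.
have [e1 e2 e3] : [/\ p1 = p0, p2 = p0 & p3 = p0] by split; lia.
subst p1 p2 p3; subst p4.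
have [L00 FT0] := split_same_min s0; have [L10 FT1] := split_same_min s1.
have [L20 _] := split_same_min s2; have [L30 _] := split_same_min s3.
subst L0 L1 L2 L3.
set q2 := head (head q0 T0) T1 in q23 T1b T2b q34 T3b s2 s3 p23 p34.
(* Otherwise the endpoints of the two inner generations lie strictly between p0 and 2 p0. There are
   fewer than p0 of them, so they form a set of [S1]. *)
have q2p : (p0.*2 <= q2)%N.
  rewrite leqNgt; apply/negP => q2p.
  apply: (split_split_not_fam s2 s3); apply: (regular_S1 FR) => i iS.
  have Tb k : k \in T3 ++ T2 -> (p0 < k < q2)%N.
    by rewrite mem_cat => /orP[/T3b|/T2b]; lia.
  have cS : (#|` [fset j in T3 ++ T2]%fset| <= #|` itv p0.+1 q2|)%N.
    apply: fsubset_leq_card; apply/fsubsetP => j; rewrite mem_itv.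
    by rewrite mem_fset_seq => /Tb.
  have /Tb ib : i \in T3 ++ T2 by rewrite -mem_fset_seq.
  apply/andP; split; first by lia.
  by apply: leq_trans cS _; rewrite card_itv; lia.
(* The endpoints of the two outer generations are at least q2 >= 2 p0, so [doublable] merges
   these. *)
apply: (split_split_not_fam s0 s1); rewrite /fam /=.
have -> : [fset i in T1 ++ T0]%fset = ([fset i in T1] `|` [fset i in T0])%fset.
  by apply/fsetP => i; rewrite in_fsetU !mem_fset_seq mem_cat.
apply: (Fd p0) => // i; rewrite ?mem_fset_seq.
- by move=> j; rewrite !mem_fset_seq => /T1b ib /T0b; lia.
- by move=> /T1b; lia.
- by move=> /T0b; lia.
Qed.

Hypothesis w_mono : {homo w : a b / (a <= b)%N}.
Hypothesis F_doublable : doublable F \/ forall a b, w a = w b.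

(** Every four levels lam(q) - lam(p) drops by [w] of the current left endpoint. After s rounds that
    endpoint is at least p + s, unless [w] is constant and its position is irrelevant. *)
Lemma good_bound k m p q : (0 < p)%N -> good (4 * k + m) p q ->
  (lam p + \sum_(s < k) w (p + s) <= lam q)%N.
Proof.
elim: k p q => [|k IH] p q p0.
  move=> g; rewrite big_ord0 addn0; apply: lam_mono; rewrite leqNgt.
  by apply/negP => /ltnW/Nrm_nil qp; rewrite /good !qp ltxx in g.
rewrite mulnS -addnA !addSn add0n => /(good_four p0)[p4 [q4 [g4 pq4 l4 d4]]].
have {IH g4} := IH p4 q4 ltac:(lia) g4.
rewrite big_ord_recl addn0.
have : (\sum_(i < k) w (p + lift ord0 i) <= \sum_(s < k) w (p4 + s))%N.
  apply: leq_sum => i _; rewrite lift0.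
  case: F_doublable => [/d4 lt|wc]; first by apply: w_mono; lia.
  by rewrite (wc _ 0%N) (wc (p4 + i)%N 0%N).
lia.
Qed.

Lemma Nrm_stable k n m : (lam n.+1 < \sum_(s < k) w s.+1)%N ->
  (4 * k <= m)%N -> Nrm m 1 n.+1 = Nrm (4 * k) 1 n.+1.
Proof.
move=> lt /subnKC <-; elim: (m - _)%N => [|d IH]; first by rewrite addn0.
rewrite -IH addnS; apply/eqP; rewrite eq_le Nrm_leS andbT leNgt.
apply/negP => g; have := @good_bound k d 1 n.+1 isT g.
have -> : (\sum_(s < k) w (1 + s) = \sum_(s < k) w s.+1)%N by [].
by lia.
Qed.

(** * [Nrm] is the maximum over functionals of the given level *)

Lemma sumN_nth N s b : sumN N s b =
  \sum_(0 <= k < size s) N (nth b s k) (nth b s k.+1).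
Proof.
elim: s => [|a s IH] /=; first by rewrite big_geq.
by rewrite big_nat_recl//= IH; congr (N a _ + _); case: s {IH}.
Qed.

Lemma nth_codom_ord d (A : 'I_d -> nat) b (i : 'I_d) : nth b (codom A) i = A i.
Proof. by rewrite /codom /image_mem (nth_map i) ?nth_ord_enum// size_enum_ord. Qed.

Lemma W_le_Nrm m f : W_level F m f -> forall a b,
  (forall i, supp f i -> (a <= i < b)%N) -> f x <= Nrm m a b.
Proof.
move: m f; apply: W_level_ind => [i i0|m f IH a b /IH/le_trans|m d g d0 Wg IH Sg Fg a b fab].
- have H a b : (a <= i < b)%N -> `|x i| <= Nrm 0 a b.
    move=> iab; apply: (le_bigmax_seq 0 i xpredT (fun i => `|x i|)) => //.
    by rewrite mem_index_iota.
  split=> a b fab; (apply: le_trans (H a b _); last apply: fab).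
  + exact: ler_norm.
  + by rewrite suppE /estar unit_vecE eqxx oner_eq0.
  + by rewrite /estar -normrN ler_norm.
  + by rewrite suppE /estar unit_vecE eqxx oppr_eq0 oner_eq0.
- by apply; apply: Nrm_leS.
have gab i y : supp (g i) y -> (a <= y < b)%N.
  move=> gy; apply: fab; rewrite suppE mulf_neq0 ?invr_eq0//.
  by rewrite (sum_coef Sg gy).
pose A i := minimum 0%N (supp (g i)).
have A1 i : supp (g i) (A i) by have [] := W_min (Wg i).
have A2 i y : supp (g i) y -> (A i <= y)%N by have [_] := W_min (Wg i); apply.
have sA : size (codom A) = d by rewrite size_codom card_ord.
have cA : admissible a b (codom A).
  split.
  - apply/(sortedP b) => k; rewrite sA => kd.
    rewrite (nth_codom_ord A b (Ordinal kd)) (nth_codom_ord A b (Ordinal (ltnW kd))).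
    by have [_ _] := Sg (Ordinal (ltnW kd)) (Ordinal kd) (ltnSn k); apply.
  - by move=> _ /codomP[k ->]; apply: gab (A1 k).
  - apply: (regular_hereditary FR) Fg; apply/fsubsetP => y; rewrite mem_fset_seq.
    by move=> /codomP[k ->]; apply/imfsetP; exists k.
apply: le_trans (Nrm_step m cA).
rewrite ler_pM2l ?invr_gt0// sumN_nth sA big_mkord; apply: ler_sum => i _.
rewrite nth_codom_ord; apply: IH => y gy; rewrite A2//=.
have [lt|ge] := ltnP i.+1 d.
  rewrite (nth_codom_ord A b (Ordinal lt)).
  by have [_ _] := Sg i (Ordinal lt) (ltnSn i); apply.
by rewrite nth_default ?sA//; have /andP[] := gab _ _ gy.
Qed.

(** The functionals chosen on the pieces may start later than the pieces themselves; spreading keeps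
    their minima in [F]. *)
Lemma Nrm_attained m a b : (0 < a < b)%N -> exists f,
  [/\ W_level F m f, forall i, supp f i -> (a <= i < b)%N & f x = Nrm m a b].
Proof.
elim: m a b => [|m IH] a b /andP[a0 ab].
  rewrite /Nrm; have [i [iab ->]] : exists i, (a <= i < b)%N /\
      \big[Num.max/0]_(a <= i < b) `|x i| = `|x i|.
    have [v0|[i [iab _ ->]]] := bigmax_attained (index_iota a b) xpredT (fun i => `|x i|).
      (* A maximum equal to 0 means that [x] vanishes on [a, b), so any coordinate there attains
         it. *)
      exists a; rewrite leqnn ab v0; split=> //; apply/eqP.
      rewrite eq_le normr_ge0/= -[leRHS]v0.
      by apply: (le_bigmax_seq 0 a xpredT (fun i => `|x i|)); rewrite ?mem_index_iota ?leqnn.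
    by exists i; rewrite -mem_index_iota.
  have i0 : (0 < i)%N by lia.
  have [x0|x0] := leP 0 (x i).
    exists (estar i); split => [|k /estar_supp ->//|]; last by rewrite ger0_norm.
    by exists i => //; left.
  exists (fun y => - estar i y); split => [|k|]; last by rewrite ltr0_norm.
    by exists i => //; right.
  by rewrite suppE oppr_eq0 => /estar_supp ->.
have [f [Wf fab fx]] := IH a b ltac:(by rewrite a0).
have [->|[s [ss sab Fs] e]] := Nrm_case m a b; first by exists f; split => //; left.
(* [W] has no functional with an empty decomposition; but then the value is 0 and the one from the
   level below serves. *)
case: (eqVneq s [::]) => [s0|s0].
  exists f; split => //; first by left.
  apply/eqP; rewrite fx eq_le Nrm_leS e s0 /= mulr0; exact: Nrm_ge0.
rewrite e {f Wf fab fx e}.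
pose d := size s.
have nth_lt (i : 'I_d) : (a <= nth b s i < nth b s i.+1)%N /\ (nth b s i.+1 <= b)%N.
  have /sab ib := mem_nth b (ltn_ord i).
  have [lt|ge] := ltnP i.+1 d; last by rewrite (nth_default _ ge) ib.
  have /sab/andP[_ nb] := mem_nth b lt; have /sortedP-/(_ b i lt) nlt := ss.
  by split; [rewrite (andP ib).1|exact: ltnW].
have /choice[g gP] : forall i : 'I_d, exists f, [/\ W_level F m f,
   forall k, supp f k -> (nth b s i <= k < nth b s i.+1)%N &
   f x = Nrm m (nth b s i) (nth b s i.+1)].
  by move=> i; apply: IH; have := nth_lt i; lia.
have gW i : W_level F m (g i) by have [] := gP i.
have gS i k : supp (g i) k -> (nth b s i <= k < nth b s i.+1)%N by have [_ + _] := gP i; apply.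
have gSb i k : supp (g i) k -> (a <= k < b)%N.
  by move=> /gS; have := nth_lt i; lia.
have g_lt (i j : 'I_d) : (i < j)%N -> set_lt (supp (g i)) (supp (g j)).
  move=> ij; split; [by have [] := W_supp (gW i)|by have [] := W_supp (gW j)|].
  move=> y z /gS yi /gS zj; suff : (nth b s i.+1 <= nth b s j)%N by lia.
  move: ij; rewrite leq_eqVlt => /orP[/eqP->//|ij].
  apply: ltnW; apply: (sorted_ltn_nth ltn_trans b ss) => //; rewrite inE.
    exact: ltn_trans (ltn_ord j).
  exact: ltn_ord.
have sd : (0 < d)%N by rewrite lt0n size_eq0.
exists (fun y => 2^-1 * \sum_(i < d) g i y); split.
- right; exists d, g; split => //.
  (* The spreading map takes the left endpoint of a piece to the minimum of the support of the
     functional on it. *)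
  pose h y := if insub (index y s) is Some i then minimum 0%N (supp (g i)) else y.
  have us : uniq s by apply: sorted_uniq ss; [exact: ltn_trans|exact: ltnn].
  have hE (i : 'I_d) : h (nth b s i) = minimum 0%N (supp (g i)).
    by rewrite /h index_uniq// valK.
  have sE y : y \in s -> exists i : 'I_d, y = nth b s i.
    by move=> ys; have id := ys; rewrite -index_mem in id;
      exists (Ordinal id); rewrite /= nth_index.
  have -> : [fset minimum 0%N (supp (g i)) | i in 'I_d]%fset =
            [fset h y | y in [fset y in s]]%fset.
    apply/fsetP => y; apply/imfsetP/imfsetP => [[i _ ->]|[z /= + ->]].
      by exists (nth b s i); rewrite ?hE//= mem_fset_seq mem_nth.
    by rewrite mem_fset_seq => /sE[i ->]; exists i; rewrite ?hE.
  apply: (regular_spreading FR) => //.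
    move=> y z; rewrite !mem_fset_seq => /sE[i ->] /sE[j ->]; rewrite !hE => ij.
    have [lt|gt|eq] := ltngtP i j.
    - by have [_ _] := g_lt i j lt; apply; [case: (W_min (gW i))|case: (W_min (gW j))].
    - have := sorted_ltn_nth ltn_trans b ss j i; rewrite !inE !ltn_ord => /(_ isT isT gt).
      by rewrite /ltn /=; lia.
    - by move: ij; rewrite eq ltnn.
  move=> y; rewrite mem_fset_seq => /sE[i ->]; rewrite hE.
  by have [/gS/andP[]] := W_min (gW i).
- move=> y; rewrite suppE mulf_eq0 negb_or => /andP[_ /sum_coef_neq0[k]].
  exact: gSb.
- by congr (_ * _); rewrite sumN_nth big_mkord; apply: eq_bigr => i _; have [_ _ ->] := gP i.
Qed.

End tree_norm.

(** * Depth of norming functionals *)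

Lemma minimum_eq d (T : porderType d) (x0 a : T) (A : set T) :
  A a -> lbound A a -> minimum x0 A = a.
Proof.
move=> Aa la; have [Am lm] := xgetPex x0 (ex_intro (A `&` lbound A) a (conj Aa la)).
by apply/le_anti; rewrite lm//= la.
Qed.

Lemma maximum_eq d (T : porderType d) (x0 a : T) (A : set T) :
  A a -> ubound A a -> maximum x0 A = a.
Proof.
move=> Aa la; have [Am lm] := xgetPex x0 (ex_intro (A `&` ubound A) a (conj Aa la)).
by apply/le_anti; rewrite la//= lm.
Qed.

Section depths.
Variables (R : realType) (F : nat_family).
Implicit Types (f : functional R) (x : c00 R).

Lemma minimum_natr (A : set nat) : A !=set0 ->
  minimum +oo%E [set (m%:R%:E : \bar R) | m in A] = (minimum 0%N A)%:R%:E.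
Proof.
move=> /minimum_nat[mA lA]; apply: minimum_eq; first by exists (minimum 0%N A).
by move=> _ [m Am <-]; rewrite lee_fin ler_nat lA.
Qed.

Lemma depth_level m f : W_level F m f -> exists2 k, (k <= m)%N &
  depth F f = k%:R%:E /\ W_level F k f.
Proof.
move=> Wm; have A0 : [set m | W_level F m f] !=set0 by exists m.
have [Wk lk] := minimum_nat A0; exists (minimum 0%N [set m | W_level F m f]).
  exact: lk.
by split => //; rewrite /depth minimum_natr.
Qed.

Definition norming x f := W F f /\ (f x)%:E = norm F x.

Lemma norm_depth_level m x f : W_level F m f -> (f x)%:E = norm F x ->
  exists k, [/\ (k <= m)%N, norm_depth F x = k%:R%:E &
    exists g, W_level F k g /\ (g x)%:E = norm F x].
Proof.
move=> Wf fx.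
pose D := [set k | exists g, [/\ norming x g, W_level F k g & depth F g = k%:R%:E]].
have normW k g : W_level F k g -> W F g by exists k.
have [k0 k0m [dk0 Wk0]] := depth_level Wf.
have Dk0 : D k0 by exists f; split => //; split => //; exact: normW Wf.
have D0 : D !=set0 by exists k0.
have [[g [[_ gx] Wg dg]] lk] := minimum_nat D0.
exists (minimum 0%N D); split; first exact: leq_trans (lk _ Dk0) k0m.
  rewrite -minimum_natr// /norm_depth; congr minimum; apply/seteqP; split.
    move=> _ [h [[m' _ /depth_level[k _ [dk Wk]]] hx] <-]; exists k => //.
    by exists h; split => //; split => //; exact: normW Wk.
  by move=> _ [k [h [[Wh hx] Wk <-]] <-]; exists h.
by exists g.
Qed.

(** A level [K] sufficient for all vectors makes every minimum and maximum behind [j] genuine, so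
    that none takes the value +oo; only then does a lower bound for one vector pass to [j]. *)
Lemma j_bounds n K :
  (forall x, (forall i, i \in finsupp x -> (1 <= i <= n)%N) ->
     exists f, W_level F K f /\ (f x)%:E = norm F x) ->
  j R F n <= K%:R /\
  forall x d, (forall i, i \in finsupp x -> (1 <= i <= n)%N) ->
    (forall m f, W_level F m f -> (f x)%:E = norm F x -> (d <= m)%N) ->
    d%:R <= j R F n.
Proof.
move=> H.
set dom := [set x : c00 R | forall i, i \in finsupp x -> (1 <= i <= n)%N].
pose D := [set k | exists2 x, dom x & norm_depth F x = k%:R%:E :> \bar R].
have DP x : dom x -> exists k, [/\ (k <= K)%N, D k, norm_depth F x = k%:R%:E &
    exists g, W_level F k g /\ (g x)%:E = norm F x].
  move=> dx; have [f [Wf fx]] := H x dx.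
  by have [k [kK dk gk]] := norm_depth_level Wf fx; exists k; split => //; exists x.
have D0 : exists k, `[< D k >].
  have [|k [_ Dk _ _]] := DP [fsfun]; first by move=> i; rewrite finsupp0.
  by exists k; apply/asboolP.
have DK k : `[< D k >] -> (k <= K)%N.
  move=> /asboolP[x /DP[k' [k'K _ -> _]] [/eqP]].
  by rewrite eqr_nat => /eqP <-.
case: (ex_maxnP D0 DK) => k /asboolP Dk maxk.
have -> : j R F n = k%:R.
  rewrite /j /norm_depth_max (@maximum_eq _ _ _ (k%:R%:E : \bar R))//.
  move=> _ [x /DP[k' [_ Dk' -> _]] <-]; rewrite lee_fin ler_nat maxk//.
  exact/asboolP.
split; first by rewrite ler_nat DK//; apply/asboolP.
move=> x d /DP[k' [_ Dk' _ [g [Wg gx]]]] /(_ _ _ Wg gx) dk'; rewrite ler_nat.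
by apply: leq_trans dk' (maxk _ _); apply/asboolP.
Qed.

Lemma norm_eq x v : (exists2 f, W F f & f x = v) -> (forall f, W F f -> f x <= v) ->
  norm F x = v%:E.
Proof.
move=> [f Wf <-] H; apply/eqP; rewrite eq_le; apply/andP; split.
  by apply: ge_ereal_sup => _ [g Wg <-]; rewrite lee_fin H.
by apply: ereal_sup_ubound; exists f.
Qed.

End depths.

(** Any competitor, of whatever level and support, is brought back to [1, n] by [Nrm_trunc] and to
    level 4k by [Nrm_stable]. *)
Lemma norm_attained (R : realType) (F : nat_family) (lam w : nat -> nat) k n (x : c00 R) :
  regular F -> gap F lam w -> {homo lam : a b / (a <= b)%N} ->
  {homo w : a b / (a <= b)%N} -> (doublable F \/ forall a b, w a = w b) ->
  (0 < n)%N -> (lam n.+1 < \sum_(s < k) w s.+1)%N ->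
  (forall i, i \in finsupp x -> (1 <= i <= n)%N) ->
  exists f, W_level F (4 * k) f /\ (f x)%:E = norm F x.
Proof.
move=> FR Fgap lamM wM Fd n0 lt xn.
have [f [Wf fab fx]] := @Nrm_attained _ _ FR x (4 * k) 1 n.+1 n0.
exists f; split=> //; rewrite fx; symmetry; apply: norm_eq.
  by exists f => //; exists (4 * k)%N.
move=> g [m _ Wg]; pose m' := maxn m (4 * k).
have {}Wg := W_level_le (leq_maxl m (4 * k)) Wg.
have [_ [B gB]] := W_supp Wg.
apply: (le_trans (W_le_Nrm FR x Wg (a := 1) (b := maxn B n.+1) _)).
  by move=> i /gB; lia.
rewrite -(Nrm_stable FR x Fgap lamM wM Fd lt (leq_maxr m (4 * k))).
apply: Nrm_trunc; first by [].
  by lia.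
move=> i ni; apply/eqP; apply: contraTT isT => xi.
by have := xn i; rewrite mem_finsupp => /(_ xi); lia.
Qed.

(** * Vectors with deep norming functionals *)

(** Spread by moving [b] to M + 1 and every element beyond M up by one: a second slot below the root
    is traded for a longer interval. *)
Lemma regular_shift (F : nat_family) (m a b M r : nat) : regular F ->
  (m < a)%N -> (a < b <= M)%N ->
  F (m |` (a |` (b |` itv M.+1 (M + r).+1)))%fset ->
  F (m |` (a |` itv M.+1 (M + r).+2))%fset.
Proof.
move=> FR ma abM; set A := (m |` _)%fset => hA.
pose h y := if y == b then M.+1 else if (M < y)%N then y.+1 else y.
have hm : h m = m by rewrite /h; case: eqP => [|_]; [lia|case: ltnP; lia].
have ha : h a = a by rewrite /h; case: eqP => [|_]; [lia|case: ltnP; lia].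
have hb : h b = M.+1 by rewrite /h eqxx.
have hM y : (M < y)%N -> h y = y.+1.
  by move=> My; rewrite /h; case: eqP => [|_]; [lia|case: ltnP; lia].
have AP y : y \in A -> [\/ y = m, y = a, y = b | (M < y)%N].
  rewrite !inE mem_iota => /or4P[/eqP->|/eqP->|/eqP->|yM]; by [constructor|constructor; lia].
apply: (regular_hereditary FR) (regular_spreading FR (h := h) _ _ hA).
- apply/fsubsetP => y; rewrite !inE mem_iota => yE; apply/imfsetP.
  have [->|ym] := eqVneq y m; first by exists m; rewrite ?hm// !inE eqxx.
  have [->|ya] := eqVneq y a; first by exists a; rewrite ?ha// !inE eqxx orbT.
  have [->|yM] := eqVneq y M.+1; first by exists b; rewrite ?hb// !inE eqxx !orbT.
  by exists y.-1; [rewrite /= !inE mem_iota; lia|rewrite hM; lia].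
- move=> y z /AP yA /AP zA; case: yA => yA; case: zA => zA; subst;
    rewrite ?hm ?ha ?hb ?(hM _ yA) ?(hM _ zA); lia.
- by move=> y /AP[->|->|->|yA]; rewrite ?hm ?ha ?hb ?(hM _ yA); lia.
Qed.

Section hard_vectors.
Variables (R : realType) (F : nat_family).
Hypothesis FR : regular F.
Hypothesis F_swap : swappable F.
Implicit Types (f g : functional R) (x : c00 R).

(** Every combination halves, so only [estar y] itself has coefficient 1 at [y]. *)
Lemma W_coef m f y : W_level F m f ->
  f = estar y \/ f (unit_vec R y) <= 2^-1.
Proof.
move: m f; apply: W_level_ind => [i i0|//|m d g d0 _ IH Sg _].
  split; last by right; rewrite /estar unit_vecE (@le_trans _ _ 0)// oppr_le0 ler0n.
  by rewrite /estar unit_vecE; case: eqP => [->|_]; [left|right; rewrite invr_ge0].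
right; have [[k ky]|H] := pselect (exists k, supp (g k) y).
  rewrite (sum_coef Sg ky) ger_pMr ?invr_gt0//.
  by case: (IH k) => [->|]; [rewrite /estar unit_vecE eqxx|lra].
by rewrite big1 ?mulr0 ?invr_ge0// => i _; apply/eqP/negP => /negP iy; apply: H; exists i.
Qed.

Lemma estar_W m i : (0 < i)%N -> W_level F m (estar i : functional R).
Proof. by move=> i0; apply: (W_level_le (leq0n m)); exists i => //; left. Qed.

(** Invariant of the construction, with [v] the norm of [x]. The attaining functional must have [m]
    in its support, so that below the next root it occupies exactly that slot. *)
Definition hard (d m M : nat) x (v : R) :=
  [/\ forall i, x i != 0 -> (m <= i <= M)%N, 0 < v,
      exists k f, [/\ W_level F k f, forall i, supp f i -> (m <= i <= M)%N,
                      supp f m & f x = v],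
      forall k f, W_level F k f -> f x <= v
    & forall k f, W_level F k f -> f x = v -> (d <= k)%N].

Lemma hard0 m : (0 < m)%N -> hard 0 m m (unit_vec R m) 1.
Proof.
move=> m0; split => //.
- by move=> i; rewrite unit_vecE; case: (eqVneq m i) => [->|]; rewrite ?leqnn// eqxx.
- exists 0%N, (estar m); split => //; first exact: estar_W.
  + by move=> i /estar_supp ->; rewrite leqnn.
  + by rewrite suppE /estar unit_vecE eqxx oner_eq0.
  + by rewrite /estar unit_vecE eqxx.
- move=> k f /W_coef -/(_ m)[->|]; last lra.
  by rewrite /estar unit_vecE eqxx.
Qed.

Section step.
Variables (d m M r : nat) (x : c00 R) (v : R).
Hypothesis hx : hard d m.+1 M x v.
Hypothesis m_gt1 : (1 < m)%N.
Hypothesis mM : (m < M)%N.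
Hypothesis r_ge2 : (2 <= r)%N.
Hypothesis F_in : F (m |` (m.+1 |` itv M.+1 (M + r).+1))%fset.
Hypothesis F_notin : ~ F (m |` (m.+1 |` itv M.+1 (M + r).+2))%fset.

Let tops := m :: iota M.+1 r.
(** Missing one unit functional on [tops] costs at least beta/4, which has to exceed the v/2 that
    can be gained elsewhere. *)
Let beta := 5 * v.

Definition step_vec : c00 R :=
  [fsfun i in itv m (M + r).+1 => x i + beta * (i \in tops)%:R | 0].

Let mem_tops i : (i \in tops) = (i == m) || (M < i <= M + r)%N.
Proof. by rewrite inE mem_iota. Qed.

Let step_vecE i : step_vec i = x i + beta * (i \in tops)%:R.
Proof.
rewrite /step_vec fsfunE mem_itv; case: ifP => // ni.
have [xM _ _ _ _] := hx.
have -> : x i = 0.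
  by apply/eqP; apply: contraFT ni => /xM; lia.
have -> : (i \in tops) = false by rewrite mem_tops; lia.
by rewrite mulr0 addr0.
Qed.

Let step_top i : i \in tops -> step_vec i = beta.
Proof.
move=> it; rewrite step_vecE it mulr1; have [xM _ _ _ _] := hx.
suff -> : x i = 0 by rewrite add0r.
apply/eqP; apply: contraTT it => /xM; rewrite mem_tops; lia.
Qed.

Let step_ntop i : i \notin tops -> step_vec i = x i.
Proof. by move=> it; rewrite step_vecE (negPf it) mulr0 addr0. Qed.

Let uniq_tops : uniq tops.
Proof. by rewrite /= iota_uniq mem_iota; lia. Qed.

Let size_tops : size tops = r.+1.
Proof. by rewrite /= size_iota. Qed.

Let W_step k g : W_level F k g ->
  g step_vec = g x + beta * \sum_(y <- tops) g (unit_vec R y).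
Proof.
move=> Wg; pose B := (M + r).+1.
have [xM _ _ _ _] := hx.
rewrite (W_linear Wg (B := B)); last first.
  by move=> i; rewrite step_vecE => H; apply: contraTT H; rewrite -leqNgt => Bi;
    rewrite negbK; have -> : (i \in tops) = false by [rewrite mem_tops; lia|];
    rewrite mulr0 addr0; apply: contraTT Bi => /xM; lia.
rewrite (W_linear Wg (x := x) (B := B)); last by move=> i /xM; lia.
transitivity (\sum_(i < B) x i * g (unit_vec R i) +
   beta * \sum_(i < B | (i : nat) \in tops) g (unit_vec R i)).
  rewrite mulr_sumr [X in _ + X]big_mkcond -big_split; apply: eq_bigr => i _ /=.
  by rewrite step_vecE mulrDl; case: ifP; rewrite ?mulr1 ?mulr0 ?mul0r.
congr (_ + _ * _).
rewrite -(big_mkord (fun i => i \in tops) (fun i => g (unit_vec R i))) -big_filter.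
apply: perm_big; apply: uniq_perm => //; first by rewrite filter_uniq ?iota_uniq.
move=> i; rewrite mem_filter mem_index_iota /=.
by case: (boolP (i \in tops)) => //; rewrite mem_tops /B; lia.
Qed.

Let V := 2^-1 * (beta * r.+1%:R + v).

Let v_gt0 : 0 < v. Proof. by have [] := hx. Qed.

Let r_ge3 : 3 <= r.+1%:R :> R. Proof. by rewrite ler_nat. Qed.

Let V_gt : beta < V /\ v < V.
Proof.
have : beta * 3 <= beta * r.+1%:R by rewrite ler_pM2l// /beta; have := v_gt0; lra.
by rewrite /V /beta; have := v_gt0; move: (r.+1%:R) => t; split; lra.
Qed.

Let supp_of_neq0 k g : W_level F k g -> g x != 0 -> exists2 y, supp g y & (m < y <= M)%N.
Proof.
move=> Wg gx; have [xM _ _ _ _] := hx.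
apply: contrapT => H; case/eqP: gx.
rewrite (W_linear Wg (B := M.+1)); last by move=> i /xM; lia.
apply: big1 => i _; have [->|xi] := eqVneq (x i) 0; first by rewrite mul0r.
have [->|gi] := eqVneq (g (unit_vec R i)) 0; first by rewrite mulr0.
by case: H; exists (i : nat); [|apply: xM].
Qed.

Section two_small.
Variables (k e : nat) (g : 'I_e -> functional R).
Hypothesis Wg : forall i, W_level F k (g i).
Hypothesis Sg : forall i j : 'I_e, (i < j)%N -> set_lt (supp (g i)) (supp (g j)).
Hypothesis Fg : F [fset minimum 0%N (supp (g i)) | i in 'I_e]%fset.
Hypothesis top_g : forall y, y \in tops -> exists i, g i = estar y.

Let estar_min y : minimum 0%N (supp (estar y : functional R)) = y.
Proof.
have [] := @minimum_nat (supp (estar y : functional R)).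
  by exists y; rewrite suppE /estar unit_vecE eqxx oner_eq0.
by move=> /estar_supp.
Qed.

(** Let a < b be the minima of two functionals that see [x]. With [tops] they give {m, a, b} and the
    interval in [F]; [regular_shift] trades [b] for a longer interval and swapping replaces [a] by m
    + 1, against the maximality of [r]. *)
Lemma at_most_one_small (i j : 'I_e) : (i < j)%N -> g i x != 0 -> g j x = 0.
Proof.
move=> ij gi; apply/eqP/negP => /negP gj; apply: F_notin.
have [yi gyi yiM] := supp_of_neq0 (Wg i) gi.
have [yj gyj yjM] := supp_of_neq0 (Wg j) gj.
pose a := minimum 0%N (supp (g i)); pose b := minimum 0%N (supp (g j)).
have [ga aM] := W_min (Wg i); have [gb bM] := W_min (Wg j).
have ab : (a < b)%N by have [_ _] := Sg ij; apply.
have bj : (b <= M)%N by have := bM _ gyj; rewrite -/b; lia.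
(* The slot of [m] is taken by its own unit functional, which must precede a functional reaching
   beyond [m]. *)
have ma : (m < a)%N.
  have [u gu] := top_g (mem_head m _).
  have um : supp (g u) m by rewrite gu suppE /estar unit_vecE eqxx oner_eq0.
  have [ui|iu|/val_inj ui] := ltngtP u i.
  - by have [_ _] := Sg ui; apply.
  - by have [_ _ /(_ _ _ gyi um)] := Sg iu; lia.
  - by move: gyi; rewrite -ui gu => /estar_supp; lia.
apply: F_swap (_ : F (m |` (a |` itv M.+1 (M + r).+2))%fset); first by lia.
  by move=> y; rewrite mem_itv; lia.
apply: (@regular_shift F m a b) => //; first by rewrite ab.
apply: (regular_hereditary FR) Fg; apply/fsubsetP => y; rewrite !inE mem_iota.
case/or4P => [/eqP->|/eqP->|/eqP->|yM]; apply/imfsetP.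
- by have [u gu] := top_g (mem_head m _); exists u; rewrite //= gu estar_min.
- by exists i.
- by exists j.
- have [|u gu] := top_g (y := y); first by rewrite mem_tops; lia.
  by exists u; rewrite //= gu estar_min.
Qed.

End two_small.

Let beta_gt : 4 * v < beta. Proof. by rewrite /beta; have := v_gt0; lra. Qed.

(** A unit functional gives at most [beta] or [v], both below [V]. Below any other root, a slot of
    [tops] without its unit functional costs too much. If all are present, a single functional sees
    [x], and the value [V] forces it to norm [x], which takes [d] levels. *)
Lemma step_upper k f : W_level F k f ->
  f step_vec <= V /\ (f step_vec = V -> (d < k)%N).
Proof.
have [_ _ _ xle xlow] := hx; have [bV vV] := V_gt.
move: k f; apply: W_level_ind => [i i0|k f [le H]|k e g e0 Wg _ Sg Fg].
- have lt : `|step_vec i| < V.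
    have [it|it] := boolP (i \in tops).
      by rewrite step_top// ger0_norm// /beta; have := v_gt0; lra.
    rewrite step_ntop//; apply: le_lt_trans vV; rewrite ler_norml.
    rewrite (xle _ _ (estar_W 0 i0)) andbT lerNl.
    by apply: (xle 0%N (fun x => - estar i x)); exists i => //; right.
  split; split.
  + exact: le_trans (ler_norm _) (ltW lt).
  + move=> e; move: (le_lt_trans (ler_norm _) lt).
    by rewrite -[X in X < _]/(estar i step_vec) e ltxx.
  + by apply: le_trans (ltW lt); rewrite -normrN ler_norm.
  + move=> e; have : - step_vec i < V by apply: le_lt_trans lt; rewrite -normrN ler_norm.
    by rewrite -[X in X < _]/(- estar i step_vec) e ltxx.
- by split => // /H; apply: ltnW.
have Wf : W_level F k.+1 (fun y => 2^-1 * \sum_(i < e) g i y) by right; exists e, g.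
rewrite (W_step Wf).
have fx := xle _ _ Wf.
set c := fun y => \sum_(i < e) g i (unit_vec R y).
have c_le y : c y <= 1 /\ ((exists i, g i = estar y) \/ c y <= 2^-1).
  have [[u uy]|nu] := pselect (exists u, supp (g u) y).
    rewrite /c (sum_coef Sg uy); case: (W_coef y (Wg u)) => [gu|le].
      by rewrite gu /estar unit_vecE eqxx; split => //; left; exists u.
    by split; [lra|right].
  rewrite /c big1 ?ler01 ?invr_ge0; first by split => //; right.
  by move=> u _; apply/eqP/negP => /negP uy; apply: nu; exists u.
have cE : \sum_(y <- tops) 2^-1 * c y = 2^-1 * \sum_(y <- tops) c y by rewrite mulr_sumr.
rewrite cE.
have [all_top|] := pselect (forall y, y \in tops -> exists i, g i = estar y); last first.
  move=> /existsNP[y /not_implyP[yt ny]].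
  have [_ [//|cy]] := c_le y.
  have : \sum_(y <- tops) c y <= r.+1%:R - 2^-1.
    rewrite (perm_big _ (perm_to_rem yt)) big_cons /=.
    have : \sum_(z <- rem y tops) c z <= \sum_(z <- rem y tops) 1.
      by apply: ler_sum => z _; have [] := c_le z.
    rewrite big_const_seq count_predT iter_addr_0 size_rem// size_tops /=.
    rewrite -natr1; lra.
  move=> s_le.
  have : beta * (2^-1 * \sum_(y <- tops) c y) <= beta * (2^-1 * (r.+1%:R - 2^-1)).
    by rewrite ler_pM2l ?ler_pM2l ?invr_gt0// (lt_trans _ beta_gt)// mulr_gt0.
  move=> s_le'; suff lt : 2^-1 * (\sum_(i < e) g i x) + beta * (2^-1 * \sum_(y <- tops) c y) < V.
    by split; [exact: ltW|move=> eV; move: lt; rewrite eV ltxx].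
  apply: le_lt_trans (lerD fx s_le') _.
  by rewrite /V !mulrBr !mulrDr mulrCA; have := beta_gt; have := v_gt0; lra.
have s_le : beta * (2^-1 * \sum_(y <- tops) c y) <= beta * (2^-1 * r.+1%:R).
  rewrite ler_pM2l ?ler_pM2l ?invr_gt0//; last by rewrite (lt_trans _ beta_gt)// mulr_gt0.
  rewrite -size_tops -sum1_size natr_sum; apply: ler_sum => z _.
  by have [] := c_le z.
have [[i gi]|none] := pselect (exists i, g i x != 0); last first.
  have -> : \sum_(i < e) g i x = 0.
    by apply: big1 => i _; apply/eqP/negP => /negP gi; apply: none; exists i.
  suff lt : 2^-1 * 0 + beta * (2^-1 * \sum_(y <- tops) c y) < V.
    by split; [exact: ltW|move=> eV; move: lt; rewrite eV ltxx].
  rewrite mulr0 add0r; apply: le_lt_trans s_le _.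
  by rewrite /V mulrDr mulrCA ltrDl mulr_gt0 ?invr_gt0.
have -> : \sum_(i < e) g i x = g i x.
  rewrite (bigD1 i)//= big1 ?addr0// => j ji.
  have [lt|gt|/val_inj ij] := ltngtP i j.
  - exact: (at_most_one_small Wg Sg Fg all_top lt gi).
  - apply/eqP/negP => /negP gj; move: gi.
    by rewrite (at_most_one_small Wg Sg Fg all_top gt gj) eqxx.
  - by rewrite ij eqxx in ji.
have gv : 2^-1 * g i x <= 2^-1 * v by rewrite ler_pM2l ?invr_gt0// (xle _ _ (Wg i)).
have VE : V = 2^-1 * v + beta * (2^-1 * r.+1%:R) by rewrite /V mulrDr mulrCA addrC.
split; first by rewrite VE lerD.
move=> eV; rewrite ltnS; apply: (xlow _ _ (Wg i)).
apply: (mulfI (_ : 2^-1 != 0)); first by rewrite invr_eq0.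
by move: eV; rewrite VE; lra.
Qed.

Lemma step_attained : exists k f, [/\ W_level F k f,
  forall i, supp f i -> (m <= i <= M + r)%N, supp f m & f step_vec = V].
Proof.
have [xM _ [k [f [Wf fM fm fx]]] _ _] := hx.
(* From left to right: the unit functional at [m], the one norming [x], and the [r] unit functionals
   on the interval. *)
pose g (i : 'I_r.+2) : functional R :=
  if i == 0%N :> nat then estar m else if i == 1%N :> nat then f else estar (M + i.-1)%N.
have supp_estar i : supp (estar i : functional R) i.
  by rewrite suppE /estar unit_vecE eqxx oner_eq0.
have Wg i : W_level F k (g i).
  rewrite /g; case: eqP => _; first by apply: estar_W; lia.
  by case: eqP => _ //; apply: estar_W; move: mM; clear; lia.
pose lo (i : nat) := if i == 0%N then m else if i == 1%N then m.+1 else (M + i.-1)%N.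
pose hi (i : nat) := if i == 0%N then m else if i == 1%N then M else (M + i.-1)%N.
have g_lo i : supp (g i) (lo i).
  by rewrite /g /lo; case: eqP => _ //; case: eqP.
have g_in i y : supp (g i) y -> (lo i <= y <= hi i)%N.
  rewrite /g /lo /hi; case: eqP => _; first by move=> /estar_supp ->; rewrite leqnn.
  by case: eqP => _; [exact: fM|move=> /estar_supp ->; rewrite leqnn].
have Sg (i j : 'I_r.+2) : (i < j)%N -> set_lt (supp (g i)) (supp (g j)).
  move=> ij; split; [by exists (lo i)|by exists (lo j)|move=> y z /g_in + /g_in].
  suff : (hi i < lo j)%N by lia.
  by move: (i : nat) (j : nat) ij => [|[|a]] [|[|b]]; rewrite /hi /lo /=; lia.
have g_min i : minimum 0%N (supp (g i)) = lo i.
  apply: minimum_eq => // y /g_in/andP[+ _]; exact.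
exists k.+1, (fun y => 2^-1 * \sum_(i < r.+2) g i y); split.
- right; exists r.+2, g; split => //.
  apply: (regular_hereditary FR) F_in; apply/fsubsetP => y /imfsetP[i _ ->].
  rewrite /= g_min !inE mem_iota.
  by move: (i : nat) (ltn_ord i) => [|[|a]]; rewrite /lo /=; lia.
- move=> y; rewrite suppE mulf_eq0 negb_or => /andP[_ /sum_coef_neq0[i /g_in]].
  by move: (i : nat) (ltn_ord i) => [|[|a]]; rewrite /lo /hi /=; lia.
- have gm : supp (g ord0) m by exact: (g_lo ord0).
  by rewrite suppE mulf_neq0 ?invr_eq0// (sum_coef Sg gm).
have gE (i : 'I_r.+2) : g i step_vec = if i == 1%N :> nat then v else beta.
  have top_in (y : nat) : (y == m) || (M < y <= M + r)%N -> estar y step_vec = beta.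
    by move=> yt; rewrite /estar step_top// mem_tops.
  rewrite /g; case: eqP => [->|i0]; first by rewrite top_in ?eqxx.
  case: eqP => [_|i1]; last by rewrite top_in//; have := ltn_ord i; lia.
  rewrite (W_step Wf) fx big1_seq ?mulr0 ?addr0// => y /andP[_ yt].
  apply/eqP/negP => /negP /fM; move: yt; rewrite mem_tops; lia.
rewrite (eq_bigr _ (fun i _ => gE i)) big_ord_recl big_ord_recl /=.
rewrite sumr_const card_ord -[beta *+ r]mulr_natr /V -[r.+1%:R]natr1; lra.
Qed.

Lemma hard_step : hard d.+1 m (M + r) step_vec V.
Proof.
split.
- move=> i; rewrite step_vecE; have [xM _ _ _ _] := hx.
  have [->|/xM] := eqVneq (x i) 0; last by lia.
  rewrite add0r mulf_eq0 negb_or => /andP[_]; rewrite pnatr_eq0 eqb0 negbK mem_tops; lia.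
- exact: lt_trans v_gt0 (V_gt.2).
- exact: step_attained.
- by move=> k f /step_upper[].
- by move=> k f /step_upper[].
Qed.

End step.
End hard_vectors.

(** * Iterating the step *)

Section chain.
Variables (R : realType) (F : nat_family) (lam w : nat -> nat).
Hypothesis FR : regular F.
Hypothesis F_swap : swappable F.
Hypothesis F_bounded : bounded F lam w.
Hypothesis lam_mono : {homo lam : a b / (a <= b)%N}.
Hypothesis lam_unbounded : forall k, exists n, (k < lam n)%N.

(** For r = 2 the set has four elements, hence is in [S1] when m >= 4; [bounded] prevents extending
    it forever. Having r >= 2 is what puts [beta] below [V]. *)
Lemma tops_exist m M : (4 <= m)%N -> (m < M)%N -> exists r,
  [/\ (2 <= r)%N, F (m |` (m.+1 |` itv M.+1 (M + r).+1))%fset &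
      ~ F (m |` (m.+1 |` itv M.+1 (M + r).+2))%fset].
Proof.
move=> m4 mM; apply: contrapT => H.
have Fr r : F (m |` (m.+1 |` itv M.+1 (M + r.+2).+1))%fset.
  elim: r => [|r IH]; last first.
    by rewrite addnS; apply: contrapT => nF; apply: H; exists r.+2.
  apply: (regular_S1 FR) => i; rewrite !inE mem_iota => iE.
  have cA : (#|` m |` (m.+1 |` itv M.+1 (M + 2).+1)|%fset <= 4)%N.
    by rewrite !cardfsU1 card_itv; do 2 case: (_ \notin _); lia.
  apply/andP; split; last apply: leq_trans cA _; lia.
have [n ln] := lam_unbounded (lam M + w m).
have le : (lam n <= lam (M + n.+2))%N by apply: lam_mono; lia.
have mM1 : (1 < m < M)%N by lia.
by have := F_bounded mM1 (Fr n); lia.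
Qed.

(** Start at [l] and move left one index at a time, stopping at 4 as [tops_exist] demands; the right
    end advances by at most [w m] on the scale [lam]. *)
Lemma hard_chain l t : (t + 4 <= l)%N -> exists (x : c00 R) v M,
  [/\ hard F t (l - t) M x v, (l <= M)%N &
      (lam M <= lam l + \sum_(l - t <= m < l) w m)%N].
Proof.
elim: t => [|t IH] tl.
  exists (unit_vec R l), 1, l; rewrite subn0 big_geq ?addn0//; split => //.
  by apply: hard0; lia.
have [x [v [M [hx lM lamM]]]] := IH ltac:(lia).
have mt : (l - t = (l - t.+1).+1)%N by lia.
rewrite mt in hx; have [r [r2 Fr nFr]] := @tops_exist (l - t.+1) M ltac:(lia) ltac:(lia).
exists (step_vec (l - t.+1) M r x v), (2^-1 * (5 * v * r.+1%:R + v)), (M + r)%N.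
split; [|by lia|].
  by apply: hard_step; rewrite ?addnS//; lia.
have := F_bounded _ Fr; rewrite (big_ltn (_ : l - t.+1 < l)%N) -?mt; lia.
Qed.

Lemma hard_exists l n : (4 <= l)%N ->
  (lam l + \sum_(1 <= m < l) w m < lam n)%N ->
  exists x : c00 R, (forall i, i \in finsupp x -> (1 <= i <= n)%N) /\
    forall m f, W_level F m f -> (f x)%:E = norm F x -> (l - 4 <= m)%N.
Proof.
move=> l4 ln; have [x [v [M [[xM v0 [k [f [Wf _ _ fx]]] xle xlow] lM lamM]]]] :=
  @hard_chain l (l - 4) ltac:(lia).
exists x; split=> [i|m g Wg].
  rewrite mem_finsupp => /xM iM.
  have Mn : (M < n)%N.
    rewrite ltnNge; apply: contraTN ln => nM; rewrite -leqNgt.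
    apply: leq_trans (lam_mono nM) (leq_trans lamM _); rewrite leq_add2l.
    rewrite (@big_cat_nat _ _ _ (l - (l - 4)) 1)//=; [|lia|lia].
    exact: leq_addl.
  by lia.
rewrite (@norm_eq _ _ _ v).
- by move=> [/(xlow _ _ Wg)].
- by exists f => //; exists k.
- by move=> h [p _ Wh]; apply: xle Wh.
Qed.

End chain.

Section j_bounds.
Variables (R : realType) (F : nat_family) (lam w w' : nat -> nat).
Hypothesis FR : regular F.
Hypothesis F_swap : swappable F.
Hypothesis F_gap : gap F lam w.
Hypothesis F_bounded : bounded F lam w'.
Hypothesis lam_mono : {homo lam : a b / (a <= b)%N}.
Hypothesis lam_unbounded : forall k, exists n, (k < lam n)%N.
Hypothesis w_mono : {homo w : a b / (a <= b)%N}.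
Hypothesis F_doublable : doublable F \/ forall a b, w a = w b.

Lemma j_le n k : (0 < n)%N -> (lam n.+1 < \sum_(s < k) w s.+1)%N ->
  j R F n <= (4 * k)%:R.
Proof.
move=> n0 lt; have [] // := @j_bounds R F n (4 * k) _.
by move=> x; apply: norm_attained lt.
Qed.

Lemma j_ge n k l : (0 < n)%N -> (lam n.+1 < \sum_(s < k) w s.+1)%N ->
  (lam l + \sum_(1 <= m < l) w' m < lam n)%N -> l%:R - 4 <= j R F n.
Proof.
move=> n0 lt ln.
have [_ jlow] := @j_bounds R F n (4 * k)
  (fun x => norm_attained FR F_gap lam_mono w_mono F_doublable n0 lt).
have [l4|l4] := leqP 4 l.
  have [x [xn xlow]] := hard_exists R FR F_swap F_bounded lam_mono lam_unbounded l4 ln.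
  by have := jlow x (l - 4)%N xn xlow; rewrite natrB.
(* For l < 4 only [j] >= 0 is needed, and the zero vector shows it. *)
apply: le_trans (jlow [fsfun] 0%N _ _) => //; last by move=> i; rewrite finsupp0.
by rewrite subr_le0 ler_nat ltnW.
Qed.

End j_bounds.

(** * Orders of growth *)

Lemma theta_of_bounds (R : realType) (T : Type) (G : set_system T) (f g : T -> R)
    (c1 c2 : R) : Filter G -> 0 < c1 -> 0 < c2 ->
  (\forall x \near G, [/\ 0 <= g x, c1 * g x <= f x & f x <= c2 * g x]) ->
  f \is 'Theta_G g.
Proof.
move=> GF c10 c20 H; rewrite qualifE /=; apply/asboolP.
exists (c1, c2); first by rewrite c10.
apply: filterS H => x [g0 fg1 fg2] /=.
by rewrite !ger0_norm//; apply: le_trans fg1; rewrite mulr_ge0// ltW.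
Qed.

Lemma multiple_infty_filter (R : realType) : Filter (multiple_infty R).
Proof.
apply: filter_from_filter; first by exists 0.
move=> a b _ _; exists (Num.max a b) => // -[k n] [/= k2].
by rewrite ge_max => /andP[ha hb].
Qed.

Lemma sum_ord_double k : ((\sum_(i < k) i) * 2 = k * k.-1)%N.
Proof.
elim: k => [|k IH]; first by rewrite big_ord0.
by rewrite big_ord_recr /= mulnDl IH; case: k {IH} => // k; rewrite /=; nia.
Qed.

Section growth.
Variables (R : realType) (F : nat_family) (lam w w' : nat -> nat).
Hypothesis FR : regular F.
Hypothesis F_swap : swappable F.
Hypothesis F_gap : gap F lam w.
Hypothesis F_bounded : bounded F lam w'.
Hypothesis lam_mono : {homo lam : a b / (a <= b)%N}.
Hypothesis lam_unbounded : forall k, exists n, (k < lam n)%N.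
Hypothesis w_mono : {homo w : a b / (a <= b)%N}.
Hypothesis F_doublable : doublable F \/ forall a b, w a = w b.

(** [X] stands for log n or log^* n, and the 2 in the bound on [lam n.+1] absorbs rounding. The
    threshold 400 makes s >= 20, which turns s/2 - 5 into s/4. *)
Lemma j_sqrt_growth n (X : R) : (0 < n)%N -> (forall a, w a = a.-1) ->
  (forall a, (0 < a)%N -> (w' a <= a.*2.+1)%N) -> (forall a, (lam a <= a)%N) ->
  X <= (lam n)%:R -> (lam n.+1)%:R <= X + 2 -> 400 <= X ->
  [/\ 0 <= Num.sqrt X, 4^-1 * Num.sqrt X <= j R F n & j R F n <= 20 * Num.sqrt X].
Proof.
move=> n0 wE w'le lam_id Xle leX X400; set s := Num.sqrt X.
have s0 : 0 <= s by exact: sqrtr_ge0.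
have sX : s * s = X by rewrite -expr2 sqr_sqrtr//; lra.
have s20 : 20 <= s by rewrite leNgt; apply/negP => s20; nra.
(* The lengths sum to k(k - 1)/2, which k > 3s pushes above s ^ 2 + 2. *)
pose k := (Num.truncn (3 * s)).+2.
have /andP[kle ltk] : (k.-2)%:R <= 3 * s < (k.-1)%:R by apply: truncn_itv; lra.
have kE : k%:R = (k.-2)%:R + 2 :> R by rewrite -natrD addn2.
have k1E : (k.-1)%:R = (k.-2)%:R + 1 :> R by rewrite natr1.
have lt : (lam n.+1 < \sum_(i < k) w i.+1)%N.
  have -> : (\sum_(i < k) w i.+1 = \sum_(i < k) i)%N by apply: eq_bigr => i _; rewrite wE.
  rewrite -(ltr_nat R); apply: le_lt_trans leX _.
  have /(congr1 (fun i => i%:R : R)) := sum_ord_double k; rewrite !natrM => e.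
  move: e kE k1E ltk; move: (k%:R) (k.-1%:R) (k.-2%:R) (_ %:R) => a b c e; nra.
have := j_le R FR F_gap lam_mono w_mono F_doublable n0 lt.
rewrite natrM => jk.
split => //; last by move: jk kE kle; move: (k%:R) (k.-2%:R) => a b; lra.
(* The total consumption is at most l + 2 l ^ 2 <= s/2 + s ^ 2 / 2, below s ^ 2. *)
pose l := Num.truncn (s / 2).
have /andP[lle ltl] : l%:R <= s / 2 < l.+1%:R by apply: truncn_itv; lra.
have ll : (lam l + \sum_(1 <= m < l) w' m < lam n)%N.
  rewrite -(ltr_nat R); apply: lt_le_trans Xle.
  have sum_le : (\sum_(1 <= m < l) w' m <= 2 * l * l)%N.
    apply: (@leq_trans (\sum_(1 <= m < l) 2 * l)%N).
      rewrite !big_nat; apply: leq_sum => i /andP[i1 il].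
      by apply: leq_trans (w'le _ i1) _; move: il; clear; lia.
    by rewrite sum_nat_const_nat mulnC leq_mul2l leq_subr orbT.
  have : (lam l + \sum_(1 <= m < l) w' m <= l + 2 * l * l)%N by apply: leq_add.
  rewrite -(ler_nat R) => /le_lt_trans; apply.
  have : l%:R * l%:R <= (s / 2) * (s / 2) by rewrite ler_pM.
  have : s * 20 <= s * s by rewrite ler_wpM2l.
  by rewrite natrD !natrM; move: (l%:R) lle => a; lra.
have := j_ge R FR F_swap F_gap F_bounded lam_mono lam_unbounded w_mono F_doublable n0 lt ll.
by move: ltl; rewrite -[l.+1%:R]natr1; move: (l%:R) => a; lra.
Qed.

(** No constant depends on [kk], so the result serves both fixed and varying k. About 2Y steps of
    length kk - 1 >= kk/2 exceed X = kk Y, while Y/6 steps of length 2 kk + 1 <= 3 kk stay below it;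
    Y >= 60 turns Y/6 - 5 into Y/12. *)
Lemma j_const_growth n kk (X : R) : (0 < n)%N -> (2 <= kk)%N -> (forall a, w a = kk.-1) ->
  (forall a, w' a = kk.*2.+1) -> (forall a, (lam a <= a)%N) ->
  X <= (lam n)%:R -> (lam n.+1)%:R <= X + 2 -> 60 <= kk%:R^-1 * X ->
  12^-1 * (kk%:R^-1 * X) <= j R F n /\ j R F n <= 20 * (kk%:R^-1 * X).
Proof.
move=> n0 k2 wE w'E lam_id Xle leX; set Y := kk%:R^-1 * X => Y60.
have K2 : 2 <= kk%:R :> R by rewrite ler_nat.
have XE : X = kk%:R * Y by rewrite /Y mulVKf// pnatr_eq0; lia.
have KE : (kk.-1)%:R = kk%:R - 1 :> R by rewrite -[in RHS](prednK (ltnW k2)) -natr1 addrK.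
pose k := (Num.truncn (2 * Y + 2)).+1.
have /andP[kle ltk] : (k.-1)%:R <= 2 * Y + 2 < k%:R by apply: truncn_itv; lra.
have kE : k%:R = (k.-1)%:R + 1 :> R by rewrite natr1.
have lt : (lam n.+1 < \sum_(i < k) w i.+1)%N.
  rewrite (eq_bigr _ (fun i _ => wE _)) sum_nat_const card_ord -(ltr_nat R).
  apply: le_lt_trans leX _; rewrite natrM KE XE.
  move: (k%:R) ltk (kk%:R) K2 => a aY b b2; nra.
have := j_le R FR F_gap lam_mono w_mono F_doublable n0 lt; rewrite natrM => jk.
split; last by move: jk kE kle; move: (k%:R) (k.-1%:R) => a b; lra.
pose l := Num.truncn (Y / 6).
have /andP[lle ltl] : l%:R <= Y / 6 < l.+1%:R by apply: truncn_itv; lra.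
have ll : (lam l + \sum_(1 <= m < l) w' m < lam n)%N.
  rewrite -(ltr_nat R); apply: lt_le_trans Xle.
  have : (lam l + \sum_(1 <= m < l) w' m <= l + l * (3 * kk))%N.
    apply: leq_add => //; rewrite (eq_bigr _ (fun i _ => w'E _)) sum_nat_const_nat.
    by apply: leq_mul; lia.
  rewrite -(ler_nat R) => /le_lt_trans; apply.
  rewrite natrD !natrM XE; move: (l%:R) (ler0n R l) lle (kk%:R) K2 => a a0 aY b b2; nra.
have := j_ge R FR F_swap F_gap F_bounded lam_mono lam_unbounded w_mono F_doublable n0 lt ll.
by move: ltl; rewrite -[l.+1%:R]natr1; move: (l%:R) => a; lra.
Qed.

End growth.

Section logarithms.
Variable R : realType.
Let L (n : nat) : R := log 2 n%:R.

Lemma log_gt0 (k : nat) : (2 <= k)%N -> 0 < ln (k%:R : R).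
Proof. by move=> k2; apply: ln_gt0; rewrite ltr1n. Qed.

Lemma log_ge (k m n : nat) : (2 <= k)%N -> (k ^ m <= n)%N -> m%:R <= log k%:R n%:R :> R.
Proof.
move=> k2 mn; rewrite /log ler_pdivlMr ?log_gt0// mulr_natl -lnXn ?ltr0n; last lia.
have km : (0 < k ^ m)%N by rewrite expn_gt0; lia.
by rewrite -natrX ler_ln ?posrE ?ltr0n ?ler_nat//; lia.
Qed.

Lemma log_le (k m n : nat) : (2 <= k)%N -> (0 < n)%N -> (n <= k ^ m)%N ->
  log k%:R n%:R <= m%:R :> R.
Proof.
move=> k2 n0 mn; rewrite /log ler_pdivrMr ?log_gt0// mulr_natl -lnXn ?ltr0n; last lia.
by rewrite -natrX ler_ln ?posrE ?ltr0n ?ler_nat//; lia.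
Qed.

Lemma log_up_log n : (0 < n)%N -> L n <= (up_log 2 n)%:R /\ (up_log 2 n.+1)%:R <= L n + 2.
Proof.
move=> n0; split; first by apply: log_le => //; apply: up_logP.
have le1 : (up_log 2 n.+1 <= (up_log 2 n).+1)%N.
  by rewrite -up_log2_double// leq_up_log//; lia.
have : (up_log 2 n)%:R <= L n + 1.
  have [n1|n1] := leqP n 1.
    have -> : n = 1%N by lia.
    by rewrite up_log1 /L /log ln1 mul0r; lra.
  have := log_ge (leqnn 2) (ltnW (up_log_gtn (ltnSn 1) n1)); rewrite -/(L n).
  have : (0 < up_log 2 n)%N by rewrite up_log_gt0 n1.
  by case: up_log => //= u _; rewrite -[u.+1%:R]natr1; lra.
move: le1; rewrite -(ler_nat R) -[(up_log 2 n).+1%:R]natr1; lra.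
Qed.

Lemma up_log_id a : (up_log 2 a <= a)%N.
Proof. by apply: up_log_min => //; apply/ltnW/ltn_expl. Qed.

Lemma up_log_unbounded k : exists n, (k < up_log 2 n)%N.
Proof. by exists (2 ^ k.+1)%N; rewrite up_expnK. Qed.

Lemma log_star_id a : (log_star a <= a)%N.
Proof. by rewrite log_starP; apply/ltnW/tau_ge_id. Qed.

Lemma log_star_unbounded k : exists n, (k < log_star n)%N.
Proof. by exists (tau k 1).+1; rewrite ltnNge log_starP ltnn. Qed.

Lemma log_starS n : (log_star n.+1 <= (log_star n).+1)%N.
Proof.
rewrite log_starP /=; have : (n <= tau (log_star n) 1)%N by rewrite -log_starP.
by move=> /leq_ltn_trans; apply; apply: ltn_expl.
Qed.

Lemma j_union_bounds k n : (2 <= k)%N -> (0 < n)%N -> 60 <= k%:R^-1 * L n ->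
  12^-1 * (k%:R^-1 * L n) <= j R (union_family k S1) n /\
  j R (union_family k S1) n <= 20 * (k%:R^-1 * L n).
Proof.
case: k => // k k2 n0 L60; have [l1 l2] := log_up_log n0.
apply: (@j_const_growth R _ (up_log 2) (fun=> k) (fun=> k.+1.*2.+1)) => //.
- exact: (union_family_regular S1_regular).
- exact: union_S1_swappable.
- exact: union_S1_gap.
- exact: union_S1_bounded.
- by move=> a b; apply: leq_up_log.
- exact: up_log_unbounded.
- by right.
- exact: up_log_id.
Qed.

Lemma theta_union : (fun kn : nat * nat => j R (union_family kn.1 S1) kn.2) \is
  'Theta_(multiple_infty R) (fun kn : nat * nat => kn.1%:R^-1 * log 2 kn.2%:R : R).
Proof.
apply: (@theta_of_bounds R _ _ _ _ 12^-1 20) => //.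
  exact: multiple_infty_filter.
exists 60 => // -[k n] [/= k2 kn].
(* Since [ln] takes the value 0 at 0, the threshold excludes n = 0. *)
have n0 : (0 < n)%N.
  by case: n kn => //; rewrite /log ln0// mul0r mulr0; lra.
by have [? ?] := j_union_bounds k2 n0 kn; split => //; lra.
Qed.

Lemma log_infty (C : R) : \forall n \near \oo, (0 < n)%N /\ C <= L n.
Proof.
near=> n.
have n0 : (0 < n)%N by near: n; exact: nbhs_infty_ge.
split => //; have : (Num.truncn C).+1%:R <= L n.
  by apply: log_ge => //; near: n; exact: nbhs_infty_ge.
have [C0|C0] := leP 0 C; last by have := ler0n R (Num.truncn C).+1; lra.
by have /andP[_ ?] := truncn_itv C0; lra.
Unshelve. all: by end_near. Qed.

Lemma theta_union_fixed k : (2 <= k)%N -> (fun n : nat => j R (union_family k S1) n) \is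
  'Theta_\oo (fun n : nat => log 2 n%:R : R).
Proof.
move=> k2; have k0 : 0 < k%:R :> R by rewrite ltr0n; lia.
apply: (@theta_of_bounds R _ _ _ _ (12^-1 * k%:R^-1) (20 * k%:R^-1)).
- by rewrite mulr_gt0 ?invr_gt0.
- by rewrite mulr_gt0 ?invr_gt0.
near=> n.
have [n0 Ln] : (0 < n)%N /\ 60 * k%:R <= L n by near: n; exact: log_infty.
rewrite -/(L n) -!mulrA; have [|? ?] := j_union_bounds k2 n0.
  by rewrite mulrC ler_pdivlMr.
split => //; apply: le_trans Ln; rewrite mulr_ge0//.
Unshelve. all: by end_near. Qed.

Lemma theta_S2 : (fun n : nat => j R S2 n) \is
  'Theta_\oo (fun n : nat => Num.sqrt (log 2 n%:R) : R).
Proof.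
apply: (@theta_of_bounds R _ _ _ _ 4^-1 20) => //.
near=> n; have [n0 Ln] : (0 < n)%N /\ 400 <= L n by near: n; exact: log_infty.
have [l1 l2] := log_up_log n0.
apply: (@j_sqrt_growth R _ (up_log 2) predn S) => //.
- exact: S2_regular.
- apply: (compose_swappable S1_regular); exact: S_swappable.
- exact: S2_gap.
- exact: S2_bounded.
- by move=> a b; apply: leq_up_log.
- exact: up_log_unbounded.
- by move=> a b; lia.
- by left; apply: (compose_doublable S1_regular).
- by move=> a; lia.
- exact: up_log_id.
Unshelve. all: by end_near. Qed.

Lemma log_star_infty c : \forall n \near \oo, (c <= log_star n)%N.
Proof.
near=> n; have : (tau c 1 < n)%N by near: n; exact: nbhs_infty_ge.
by rewrite ltnNge -log_starP -ltnNge => /ltnW.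
Unshelve. all: by end_near. Qed.

Lemma theta_S3 : (fun n : nat => j R S3 n) \is
  'Theta_\oo (fun n : nat => Num.sqrt ((log_star n)%:R) : R).
Proof.
apply: (@theta_of_bounds R _ _ _ _ 4^-1 20) => //.
near=> n; have n0 : (0 < n)%N by near: n; exact: nbhs_infty_ge.
have Ln : (400 <= log_star n)%N by near: n; exact: log_star_infty.
apply: (@j_sqrt_growth R _ log_star predn (fun m => m.*2.+1)) => //.
- exact: (compose_regular S2_regular).
- apply: (compose_swappable S2_regular); apply: (compose_swappable S1_regular).
  exact: S_swappable.
- exact: S3_gap.
- exact: S3_bounded.
- by move=> a b; apply: leq_log_star.
- exact: log_star_unbounded.
- by move=> a b; lia.
- by left; apply: (compose_doublable S2_regular).
- exact: log_star_id.
- by rewrite -natrD ler_nat; have := log_starS n; lia.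
- by rewrite ler_nat.
Unshelve. all: by end_near. Qed.

End logarithms.

(** * The rate for [S_ phi] *)

Section superadditive_growth.
Variables (R : realType) (phi : nat -> nat).
Hypothesis phi_gt0 : forall a, (0 < a)%N -> (0 < phi a)%N.
Hypothesis phi_mono : forall a b, (0 < a)%N -> (a <= b)%N -> (phi a <= phi b)%N.
Hypothesis phi_add : forall a b, (0 < a)%N -> (0 < b)%N ->
  (phi a + phi b <= phi (a + b))%N.

Lemma phi_sum_inv_le n l :
  (phi_sum_inv phi n <= l)%N = (n <= \sum_(1 <= i < l.+1) phi i)%N.
Proof.
have sum_mono a b : (a <= b)%N ->
    (\sum_(1 <= i < a.+1) phi i <= \sum_(1 <= i < b.+1) phi i)%N.
  by move=> ab; rewrite (@big_cat_nat _ _ _ a.+1 1 b.+1)//= leq_addr.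
have ex : [set l | (n <= \sum_(1 <= i < l.+1) phi i)%N] !=set0.
  exists n; rewrite /= -[leqLHS]muln1 -[X in (X * _)%N](subn1 n.+1).
  rewrite -sum_nat_const_nat !big_nat; apply: leq_sum => i /andP[i1 _].
  exact: phi_gt0.
have [/= h1 h2] := minimum_nat ex.
by apply/idP/idP => [/sum_mono|]; [exact: leq_trans|exact: h2].
Qed.

Lemma j_S_bounds n (l := phi_sum_inv phi n) : (0 < n)%N -> (10 <= l)%N ->
  2^-1 * l%:R <= j R (S_ phi) n /\ j R (S_ phi) n <= 12 * l%:R.
Proof.
(* Nothing is known about phi(0); resetting it to 0 makes [w] monotone on all of nat. *)
move=> n0 l10; pose w a := if a is 0%N then 0%N else phi a.
have FR := S_regular phi_gt0 phi_mono phi_add.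
have Fg : gap (S_ phi) id w.
  by move=> [//|p0] p2 q2 q0 p02 pq; apply: (S_gap phi_mono).
have w_mono : {homo w : a b / (a <= b)%N}.
  by move=> [|a] [|b] // ab; apply: phi_mono.
have Fd : doublable (S_ phi) \/ forall a b, w a = w b.
  by left; apply: S_doublable.
have Fs := S_swappable phi_mono.
have sumE k : (\sum_(i < k) w i.+1 = \sum_(1 <= i < k.+1) phi i)%N.
  by rewrite big_add1 big_mkord.
(* The first [l] terms reach n; two more, each at least 1, pass n + 1. *)
have lt : (id n.+1 < \sum_(i < l.+2) w i.+1)%N.
  rewrite sumE 2?(@big_nat_recr _ _ _ _ 1)//= -addnA.
  have : (n <= \sum_(1 <= i < l.+1) phi i)%N by rewrite -phi_sum_inv_le.
  by have := phi_gt0 (ltn0Sn l); have := phi_gt0 (ltn0Sn l.+1); lia.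
have := j_le R FR Fg (fun a b h => h) w_mono Fd n0 lt; rewrite natrM -addn2 natrD => jl.
have l10R : 10 <= l%:R :> R by rewrite ler_nat.
split; last lra.
(* As l - 1 <= phi(l - 1), the left side is at most phi(1) + ... + phi(l - 1), which is below n by
   minimality of [l]. The resulting l - 5 is at least l/2 once l >= 10. *)
have ll : (id l.-1 + \sum_(1 <= m < l.-1) phi m < id n)%N.
  have : (\sum_(1 <= i < l.-1.+1) phi i < n)%N.
    by rewrite ltnNge -phi_sum_inv_le -/l -ltnNge; lia.
  apply: leq_ltn_trans; rewrite big_nat_recr/=; last lia.
  by rewrite addnC leq_add2l (superadditive_ge_id phi_gt0 phi_add)//; lia.
have unb k : exists n, (k < id n)%N by exists k.+1.
have := j_ge R FR Fs Fg (S_bounded phi_mono) (fun a b h => h) unb w_mono Fd n0 lt ll.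
have -> : (l.-1)%:R = l%:R - 1 :> R by rewrite -[in RHS](prednK (leq_trans _ l10))// -natr1 addrK.
by lra.
Qed.

Lemma phi_sum_inv_infty c : \forall n \near \oo, (c <= phi_sum_inv phi n)%N.
Proof.
near=> n; have : (\sum_(1 <= i < c.+1) phi i < n)%N by near: n; exact: nbhs_infty_ge.
by rewrite ltnNge -phi_sum_inv_le -ltnNge => /ltnW.
Unshelve. all: by end_near. Qed.

Lemma theta_S : (fun n : nat => j R (S_ phi) n) \is
  'Theta_\oo (fun n : nat => (phi_sum_inv phi n)%:R : R).
Proof.
apply: (@theta_of_bounds R _ _ _ _ 2^-1 12) => //.
near=> n; have n0 : (0 < n)%N by near: n; exact: nbhs_infty_ge.
have l10 : (10 <= phi_sum_inv phi n)%N by near: n; exact: phi_sum_inv_infty.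
by have [? ?] := j_S_bounds n0 l10.
Unshelve. all: by end_near. Qed.

Lemma theta_S_equiv (h : nat -> R) (c1 c2 : R) : 0 < c1 -> 0 < c2 ->
  (forall n, (0 < n)%N -> (2 <= phi_sum_inv phi n)%N ->
    c1 * (phi_sum_inv phi n)%:R <= h n /\ h n <= c2 * (phi_sum_inv phi n)%:R) ->
  (fun n : nat => j R (S_ phi) n) \is 'Theta_\oo h.
Proof.
move=> c10 c20 H.
apply: (@theta_of_bounds R _ _ _ _ (2^-1 * c2^-1) (12 * c1^-1)).
- by rewrite mulr_gt0 ?invr_gt0.
- by rewrite mulr_gt0 ?invr_gt0.
near=> n; have n0 : (0 < n)%N by near: n; exact: nbhs_infty_ge.
have l10 : (10 <= phi_sum_inv phi n)%N by near: n; exact: phi_sum_inv_infty.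
have [jl ju] := j_S_bounds n0 l10.
have [hl hu] := H n n0 (leq_trans (isT : 2 <= 10)%N l10).
split.
- by apply: le_trans hl; rewrite mulr_ge0// ltW.
- by apply: le_trans jl; rewrite -mulrA ler_pM2l ?invr_gt0// ler_pdivrMl.
- by apply: le_trans ju _; rewrite -mulrA ler_pM2l// ler_pdivlMl.
Unshelve. all: by end_near. Qed.

End superadditive_growth.

Section powers.
Variable R : realType.

Lemma powR_root (m : nat) (x : R) : (0 < m)%N -> 0 <= x -> (x ^+ m) `^ (m%:R^-1) = x.
Proof.
move=> m0 x0; rewrite -powR_mulrn// -powRrM mulfV ?powRr1//.
by rewrite pnatr_eq0 -lt0n.
Qed.

Lemma powR_root_le (m : nat) (x y : R) : (0 < m)%N -> 0 <= x -> 0 <= y ->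
  x ^+ m <= y -> x <= y `^ (m%:R^-1).
Proof.
move=> m0 x0 y0 xy; rewrite -[leLHS](powR_root m0)//.
by apply: ge0_ler_powR; rewrite ?invr_ge0// nnegrE ?exprn_ge0.
Qed.

Lemma powR_root_ge (m : nat) (x y : R) : (0 < m)%N -> 0 <= x -> 0 <= y ->
  y <= x ^+ m -> y `^ (m%:R^-1) <= x.
Proof.
move=> m0 x0 y0 xy; rewrite -[leRHS](powR_root m0)//.
by apply: ge0_ler_powR; rewrite ?invr_ge0// nnegrE ?exprn_ge0.
Qed.

Lemma sum_pow_le k l : (\sum_(1 <= i < l.+1) i ^ k <= l ^ k.+1)%N.
Proof.
rewrite expnS -[l in (l * _)%N]subn0 -[X in (X * _)%N]/(l.+1 - 1)%N.
rewrite -sum_nat_const_nat !big_nat; apply: leq_sum => i /andP[_ il].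
by case: (k) => [|k']; rewrite ?expn0// leq_exp2r.
Qed.

(** Discrete mean value estimate, telescoped in [sum_pow_ge] to compare the power sum with the
    integral. *)
Lemma expS_le k a : (a.+1 ^ k.+1 <= a ^ k.+1 + k.+1 * a.+1 ^ k)%N.
Proof.
elim: k => [|k IH]; first by rewrite !expn1 expn0; lia.
have aa : (a ^ k.+1 <= a.+1 ^ k.+1)%N by rewrite leq_exp2r.
rewrite expnS; apply: leq_trans (leq_mul (leqnn _) IH) _.
by rewrite [(a ^ k.+2)%N]expnS [(a.+1 ^ k.+1)%N]expnS in aa *; nia.
Qed.

Lemma sum_pow_ge k l : (l ^ k.+1 <= k.+1 * \sum_(1 <= i < l.+1) i ^ k)%N.
Proof.
elim: l => [|l IH]; first by rewrite exp0n.
rewrite big_nat_recr//= mulnDr; apply: leq_trans (expS_le _ _) _.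
by rewrite leq_add2r.
Qed.

Lemma sum_exp_le k l : (2 <= k)%N -> (\sum_(1 <= i < l.+1) k ^ i < k ^ l.+1)%N.
Proof.
move=> k2; elim: l => [|l IH]; first by rewrite big_geq// expn_gt0; lia.
rewrite big_nat_recr//= [X in (_ < X)%N]expnS.
by have := leq_mul k2 (leqnn (k ^ l.+1)); lia.
Qed.

Lemma theta_pow k : (1 <= k)%N ->
  (fun n : nat => j R (S_ (fun i => (i ^ k)%N)) n) \is
    'Theta_\oo (fun n : nat => n%:R `^ (k.+1%:R^-1) : R).
Proof.
move=> k1.
have g0 a : (0 < a)%N -> (0 < a ^ k)%N by rewrite expn_gt0 => ->.
have mono a b : (0 < a)%N -> (a <= b)%N -> (a ^ k <= b ^ k)%N.
  by move=> _ ab; rewrite leq_exp2r.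
have add a b : (0 < a)%N -> (0 < b)%N -> (a ^ k + b ^ k <= (a + b) ^ k)%N.
  move=> a0 b0; case: k k1 {g0 mono} => // k _; rewrite !expnS mulnDl.
  by apply: leq_add; rewrite leq_mul2l; case: (k) => [|k'];
    rewrite ?expn0 ?leq_exp2r ?leq_addr ?leq_addl ?orbT.
apply: (@theta_S_equiv R _ g0 mono add _ (2 * k.+1%:R)^-1 1) => //.
move=> n n0; set l := phi_sum_inv _ n => l2.
have nl : (n <= l ^ k.+1)%N.
  by apply: leq_trans (sum_pow_le k l); rewrite -phi_sum_inv_le.
have ln : (l.-1 ^ k.+1 <= k.+1 * n)%N.
  apply: leq_trans (sum_pow_ge _ _) _; rewrite leq_mul2l/=; apply: ltnW.
  by rewrite ltnNge -phi_sum_inv_le// -/l -ltnNge; lia.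
split; last first.
  by rewrite mul1r; apply: powR_root_ge; rewrite // -natrX ler_nat.
(* Dividing by k + 1 rather than by its (k+1)-st root avoids a second root, at the price of a factor
   depending only on k. *)
have lK : (l.-1)%:R / k.+1%:R <= n%:R `^ (k.+1%:R^-1) :> R.
  apply: powR_root_le; rewrite ?divr_ge0//.
  rewrite expr_div_n ler_pdivrMr ?exprn_gt0// -!natrX -natrM ler_nat mulnC.
  apply: leq_trans ln _; rewrite leq_mul2r; apply/orP; right.
  by rewrite expnS leq_pmulr ?expn_gt0.
apply: le_trans lK; rewrite invfM mulrC mulrA ler_pM2r ?invr_gt0//.
have : l%:R <= (2 * l.-1)%:R :> R by rewrite ler_nat; lia.
by rewrite natrM; lra.
Qed.

Lemma theta_exp k : (2 <= k)%N ->
  (fun n : nat => j R (S_ (fun i => (k ^ i)%N)) n) \is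
    'Theta_\oo (fun n : nat => log k%:R n%:R : R).
Proof.
move=> k2.
have g0 a : (0 < a)%N -> (0 < k ^ a)%N by rewrite expn_gt0 => _; lia.
have mono a b : (0 < a)%N -> (a <= b)%N -> (k ^ a <= k ^ b)%N.
  by move=> _ ab; rewrite leq_exp2l.
have add a b : (0 < a)%N -> (0 < b)%N -> (k ^ a + k ^ b <= k ^ (a + b))%N.
  move=> a0 b0; rewrite expnD.
  have ka : (2 <= k ^ a)%N by rewrite (leq_trans k2)// -[X in (X <= _)%N]expn1 leq_exp2l.
  have kb : (2 <= k ^ b)%N by rewrite (leq_trans k2)// -[X in (X <= _)%N]expn1 leq_exp2l.
  by nia.
apply: (@theta_S_equiv R _ g0 mono add _ 2^-1 2) => //.
move=> n n0; set l := phi_sum_inv _ n => l2.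
have nl : (n <= k ^ l.+1)%N.
  by apply: leq_trans (ltnW (sum_exp_le l k2)); rewrite -phi_sum_inv_le.
have ln : (k ^ l.-1 <= n)%N.
  have lt : (\sum_(1 <= i < l.-1.+1) k ^ i < n)%N.
    by rewrite ltnNge -phi_sum_inv_le// -/l -ltnNge; lia.
  apply: leq_trans (ltnW lt); rewrite big_nat_recr/=; last lia.
  exact: leq_addl.
(* The logarithm lies between l - 1 and l + 1, hence between l/2 and 2l because l >= 2. *)
have := log_ge R k2 ln; have := log_le R k2 n0 nl.
have : 2 <= l%:R :> R by rewrite ler_nat.
rewrite -[l.+1%:R]natr1.
have -> : (l.-1)%:R = l%:R - 1 :> R by rewrite -[in RHS](prednK (ltnW l2)) -natr1 addrK.
by move=> *; split; lra.
Qed.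

End powers.

Theorem theorem2 (R : realType) :
  [/\ forall phi : nat -> nat,
        (forall a : nat, (0 < a)%N -> (0 < phi a)%N) ->
        (forall a b : nat, (0 < a)%N -> (a <= b)%N -> (phi a <= phi b)%N) ->
        (forall a b : nat, (0 < a)%N -> (0 < b)%N ->
           (phi a + phi b <= phi (a + b))%N) ->
        (fun n : nat => j R (S_ phi) n) \is
          'Theta_\oo (fun n : nat => (phi_sum_inv phi n)%:R : R),
      (forall k : nat, (1 <= k)%N ->
         (fun n : nat => j R (S_ (fun i => (i ^ k)%N)) n) \is
           'Theta_\oo (fun n : nat => n%:R `^ (k.+1%:R^-1) : R)) /\
      (forall k : nat, (2 <= k)%N ->
         (fun n : nat => j R (S_ (fun i => (k ^ i)%N)) n) \is
           'Theta_\oo (fun n : nat => log k%:R n%:R : R)),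
      forall k : nat, (2 <= k)%N ->
        (fun n : nat => j R (union_family k S1) n) \is
          'Theta_\oo (fun n : nat => log 2 n%:R : R),
      (fun kn : nat * nat => j R (union_family kn.1 S1) kn.2) \is
        'Theta_(multiple_infty R)
          (fun kn : nat * nat => kn.1%:R^-1 * log 2 kn.2%:R : R)
    & ((fun n : nat => j R S2 n) \is
         'Theta_\oo (fun n : nat => Num.sqrt (log 2 n%:R) : R)) /\
      ((fun n : nat => j R S3 n) \is
         'Theta_\oo (fun n : nat => Num.sqrt ((log_star n)%:R) : R))].
Proof.
split.
- by move=> phi phi_gt0 phi_mono phi_add; exact: theta_S.
- by split; [exact: theta_pow|exact: theta_exp].
- exact: theta_union_fixed.
- exact: theta_union.
- by split; [exact: theta_S2|exact: theta_S3].
Qed.
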